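(* Let $(\mathcal L,(\cdot,\cdot),\mathcal H)\in\mathcal T$, with $\dot R$, $\dot{\mathfrak g}$, $\dot{\mathcal H}$, $\Lambda$ as in the context. Then the core $\mathcal L_c$ is a division $(\dot R,\Lambda)$-graded Lie algebra with grading pair $(\dot{\mathfrak g},\dot{\mathcal H})$, where the $\Lambda$-grading is $\mathcal L_c^\sigma=\mathcal L_c\cap\mathcal L^\sigma$ with $\mathcal L^\sigma=\sum_{\dot\alpha\in\dot R}\mathcal L_{\dot\alpha+\sigma}$ ($\sigma\in\Lambda$), and the $\dot R$-grading is by weights with respect to $\dot{\mathcal H}$ (elements of $\dot R\subseteq\mathcal H^\star$ being restricted to $\dot{\mathcal H}$).
   Context: $\mathbb F$ is a field of characteristic $0$. If $V$ is a finite-dimensional space with a non-degenerate symmetric bilinear form and $\alpha\in V^\star$, $t_\alpha$ denotes the unique element of $V$ with $(t_\alpha,v)=\alpha(v)$ for all $v\in V$. A nonzero subalgebra $\mathcal H$ of a Lie algebra $\mathcal L$ is a (split) toral subalgebra if $\mathcal L=\bigoplus_{\alpha\in\mathcal H^\star}\mathcal L_\alpha$, where $\mathcal L_\alpha=\{x\in\mathcal L:[h,x]=\alpha(h)x\ \forall h\in\mathcal H\}$. The class $\mathcal T$ consists of triples $(\mathcal L,(\cdot,\cdot),\mathcal H)$ with: (T1) $\mathcal L$ is a Lie algebra over $\mathbb F$ with a non-degenerate symmetric invariant bilinear form $(\cdot,\cdot)$; (T2) $\mathcal H$ is a finite-dimensional toral subalgebra of $\mathcal L$ and $(\cdot,\cdot)|_{\mathcal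 H\times\mathcal H}$ is non-degenerate. Put $R=\{\alpha\in\mathcal H^\star:\mathcal L_\alpha\neq0\}$ (root system), transfer the form to $\mathcal H^\star$ by $(\alpha,\beta):=(t_\alpha,t_\beta)$, and let $R^\times=\{\alpha\in R:(\alpha,\alpha)\ne0\}$, $R^0=\{\alpha\in R:(\alpha,\alpha)=0\}$; (T3) for each $\delta\in R^0$ there are $x\in\mathcal L_\delta$, $y\in\mathcal L_{-\delta}$ with $[x,y]=t_\delta$, and for each $\alpha\in R^\times$ and each $0\ne x\in\mathcal L_\alpha$ there is $y\in\mathcal L_{-\alpha}$ with $[x,y]=t_\alpha$; (T4) for $\alpha\in R^\times$ and $x\in\mathcal L_\alpha$, $\mathrm{ad}\,x$ acts locally nilpotently on $\mathcal L$; (T5) (a) $R^\times$ is not a disjoint union of two nonempty mutually orthogonal subsets, (b) for each $\delta\in R^0$ there is $\alpha\in R^\times$ with $\alpha+\delta\in R$; (T6) $\Lambda:=\mathrm{span}_{\mathbb Z}(R^0)$ is a free abelian group of finite rank. The core $\mathcal L_c$ is the subalgebra generated by the $\mathcal L_\alpha$, $\alpha\in R^\times$. A finite root system is a subset $\Delta$ containing $0$ with $\Delta^\times:=\Delta\setminus\{0\}$ a finite root system in the sense of Bourbaki; $\Delta_{red}=\{0\}\cup\{\alpha\in\Delta:\alpha/2\notin\Delta\}$. Standard setup: normalize the form so that $(\alpha_0,\alpha_0)=1$ for some $\alpha_0\in R^\times$; then $(R,R)\subseteq\mathbb Q$. Let $\mathcal V=\mathbb R\otimes_{\mathbb Q}\mathrm{span}_{\mathbb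 Q}(R)$ with the induced real positive semidefinite form, $\mathcal V^0$ its radical, $\bar{\ }:\mathcal V\to\mathcal V/\mathcal V^0$. The image $\bar R$ is an irreducible finite root system; fix a base $\{\bar\alpha_i\}_{i=1}^\ell$ and preimages $\dot\alpha_i\in R$. With $\dot{\mathcal V}=\mathrm{span}_{\mathbb R}\{\dot\alpha_i\}$, $\mathcal V=\dot{\mathcal V}\oplus\mathcal V^0$, and $\dot R:=\{\dot\alpha\in\dot{\mathcal V}:\dot\alpha+\delta\in R$ for some $\delta\in\mathcal V^0\}$ is an irreducible finite root system with base $\{\dot\alpha_i\}$, $\dot R\subseteq\mathrm{span}_{\mathbb Z}\{\dot\alpha_i\}\subseteq\mathcal H^\star$, $\dot R_{red}\subseteq R$, and $R\subseteq\dot R+\Lambda$. Let $h_\alpha=2t_\alpha/(t_\alpha,t_\alpha)$ for $\alpha\in R^\times$; fix $e_{\pm\dot\alpha_i}\in\mathcal L_{\pm\dot\alpha_i}$ with $[h_{\dot\alpha_i},e_{\pm\dot\alpha_i}]=\pm2e_{\pm\dot\alpha_i}$, $[e_{\dot\alpha_i},e_{-\dot\alpha_i}]=h_{\dot\alpha_i}$; $\dot{\mathfrak g}$ is the subalgebra generated by $\{e_{\pm\dot\alpha_i}\}$ and $\dot{\mathcal H}=\sum_i\mathbb F t_{\dot\alpha_i}=\sum_i\mathbb F h_{\dot\alpha_i}$; the form restricted to $\dot{\mathcal H}$ is non-degenerate and $t_\mu$ ($\mu\in\dot R$) is taken in $\dot{\mathcal H}$. Graded algebras: let $\Delta$ be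 an irreducible finite root system, $\mathfrak g$ a finite-dimensional split simple Lie algebra with splitting Cartan subalgebra $\mathfrak h$ and root system $\Delta_{red}$. A $\Delta$-graded Lie algebra with grading pair $(\mathfrak g,\mathfrak h)$ is a Lie algebra $\mathcal L$ containing $\mathfrak g$ as a subalgebra with $\mathcal L=\bigoplus_{\mu\in\Delta}\mathcal L_\mu$, $\mathcal L_\mu=\{x:[h,x]=\mu(h)x\ \forall h\in\mathfrak h\}$, and $\mathcal L_0=\sum_{\mu\in\Delta^\times}[\mathcal L_\mu,\mathcal L_{-\mu}]$. For an abelian group $G$ it is $(\Delta,G)$-graded if moreover $\mathcal L=\bigoplus_{g\in G}\mathcal L^g$ is a $G$-graded Lie algebra with $\mathfrak g\subseteq\mathcal L^0$ and $\{g:\mathcal L^g\ne0\}$ generating $G$; then $\mathcal L=\bigoplus_{\mu,g}\mathcal L^g_\mu$, $\mathcal L^g_\mu=\mathcal L^g\cap\mathcal L_\mu$. It is division if for all $\mu\in\Delta^\times$, $g\in G$, $0\ne x\in\mathcal L^g_\mu$ there is $y\in\mathcal L^{-g}_{-\mu}$ with $[x,y]\equiv t_\mu\pmod{Z(\mathcal L)}$. *)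

(* Defs.v *)
From HB Require Import structures.
From mathcomp Require Import all_boot all_order all_algebra.
Set Implicit Arguments.
Unset Strict Implicit.
Unset Printing Implicit Defensive.
Import Order.TTheory GRing.Theory Num.Theory.
Local Open Scope ring_scope.

Section LieDefs.
Variables (F : fieldType) (L : lmodType F) (br : L -> L -> L) (B : L -> L -> F).

Definition lie_bracket : Prop :=
  (forall a x y z, br (a *: x + y) z = a *: br x z + br y z) /\
  (forall a x y z, br z (a *: x + y) = a *: br z x + br z y) /\
  (forall x, br x x = 0) /\
  (forall x y z, br x (br y z) + br y (br z x) + br z (br x y) = 0).

Definition nondeg_sym_inv_form : Prop :=
  (forall a x y z, B (a *: x + y) z = a * B x z + B y z) /\
  (forall x y, B x y = B y x) /\
  (forall x y z, B (br x y) z = B x (br y z)) /\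
  (forall x, (forall y, B x y = 0) -> x = 0).

Definition subalg (P : L -> Prop) : Prop :=
  P 0 /\ (forall a x y, P x -> P y -> P (a *: x + y)) /\
  (forall x y, P x -> P y -> P (br x y)).

Definition gen_subalg (S : L -> Prop) (x : L) : Prop :=
  forall P, subalg P -> (forall y, S y -> P y) -> P x.

Definition center_of (P : L -> Prop) (z : L) : Prop :=
  P z /\ forall w, P w -> br z w = 0.

(** V = (+)_{k in I} P k  (the P k are assumed to be already subspaces of V):
    every element of V is a finite sum of elements of the P k, and the sum is direct *)
Definition dsum (K : eqType) (I : K -> Prop) (P : K -> L -> Prop) (V : L -> Prop) : Prop :=
  (forall x, V x -> exists s : seq (K * L), uniq (map fst s) /\
      (forall p, p \in s -> I p.1 /\ P p.1 p.2) /\ x = \sum_(p <- s) p.2) /\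
  (forall s : seq (K * L), uniq (map fst s) ->
      (forall p, p \in s -> I p.1 /\ P p.1 p.2) ->
      \sum_(p <- s) p.2 = 0 -> forall p, p \in s -> p.2 = 0).

(** The finite-dimensional subalgebra H is given by a basis h; elements of H are
    hvec c, elements of H^* are row vectors al (al(hvec c) = ev al c). *)
Variables (n : nat) (h : 'I_n -> L).

Definition hvec (c : 'rV[F]_n) : L := \sum_(i < n) c 0 i *: h i.
Definition ev (al c : 'rV[F]_n) : F := \sum_(i < n) al 0 i * c 0 i.

Definition wsp (al : 'rV[F]_n) (x : L) : Prop := forall c, br (hvec c) x = ev al c *: x.

Definition gram : 'M[F]_n := \matrix_(i, j) B (h i) (h j).
(** coordinates of t_al, and t_al itself: the unique t in H with (t, v) = al(v) *)
Definition tc (al : 'rV[F]_n) : 'rV[F]_n := al *m invmx gram.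
Definition tv (al : 'rV[F]_n) : L := hvec (tc al).
Definition fdot (al be : 'rV[F]_n) : F := B (tv al) (tv be).

Definition root (al : 'rV[F]_n) : Prop := exists x, x != 0 /\ wsp al x.
Definition root_x (al : 'rV[F]_n) : Prop := root al /\ fdot al al != 0.
Definition root_0 (al : 'rV[F]_n) : Prop := root al /\ fdot al al = 0.

Definition in_Lambda (s : 'rV[F]_n) : Prop :=
  forall P : 'rV[F]_n -> Prop, P 0 -> (forall a b, P a -> P b -> P (a - b)) ->
    (forall d, root_0 d -> P d) -> P s.

Definition toral_basis : Prop :=
  (forall c, hvec c = 0 -> c = 0) /\
  (exists c, hvec c != 0) /\
  (forall c d, exists e, br (hvec c) (hvec d) = hvec e) /\
  dsum (fun _ => True) wsp (fun _ => True).

Definition form_nondeg_on_H : Prop :=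
  forall c, (forall d, B (hvec c) (hvec d) = 0) -> hvec c = 0.

Definition T3 : Prop :=
  (forall d, root_0 d -> exists x y, wsp d x /\ wsp (- d) y /\ br x y = tv d) /\
  (forall al, root_x al -> forall x, wsp al x -> x != 0 ->
      exists y, wsp (- al) y /\ br x y = tv al).

Definition T4 : Prop :=
  forall al x, root_x al -> wsp al x -> forall y, exists k, iter k (br x) y = 0.

Definition T5a : Prop :=
  forall P : 'rV[F]_n -> Prop,
    (exists al, root_x al /\ P al) -> (exists be, root_x be /\ ~ P be) ->
    exists al be, root_x al /\ P al /\ root_x be /\ ~ P be /\ fdot al be != 0.

Definition T5b : Prop := forall d, root_0 d -> exists al, root_x al /\ root (al + d).

Definition T6 : Prop :=
  exists m (b : 'I_m -> 'rV[F]_n),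
    (forall k : 'I_m -> int, \sum_(j < m) (b j) *~ k j = 0 -> forall j, k j = 0) /\
    (forall s, in_Lambda s <-> exists k : 'I_m -> int, s = \sum_(j < m) (b j) *~ k j).

Definition class_T : Prop :=
  [pchar F] =i pred0 /\ lie_bracket /\ nondeg_sym_inv_form /\
  toral_basis /\ form_nondeg_on_H /\ T3 /\ T4 /\ T5a /\ T5b /\ T6.

Definition in_core (x : L) : Prop :=
  gen_subalg (fun y => exists al, root_x al /\ wsp al y) x.

(** radical V^0 (tested on elements of the Q-span of R) *)
Definition rad (d : 'rV[F]_n) : Prop := forall be, root be -> fdot d be = 0.

(** Standard setup: dotal i are preimages in R of a base of bar R; e, f are
    the chosen e_{+dotal_i}, e_{-dotal_i}. *)
Variables (l : nat) (ad : 'I_l -> 'rV[F]_n) (e f : 'I_l -> L).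

Definition qcomb (c : 'I_l -> rat) : 'rV[F]_n := \sum_(i < l) ratr (c i) *: ad i.
Definition zcomb (k : 'I_l -> int) : 'rV[F]_n := \sum_(i < l) (k i)%:~R *: ad i.

Definition in_Rdot (mu : 'rV[F]_n) : Prop :=
  (exists c, mu = qcomb c) /\ exists al, root al /\ rad (al - mu).
Definition in_Rred (mu : 'rV[F]_n) : Prop :=
  in_Rdot mu /\ (mu = 0 \/ ~ in_Rdot (2^-1 *: mu)).

Definition hv (al : 'rV[F]_n) : L := hvec ((2 / fdot al al) *: tc al).

Definition standard_setup : Prop :=
  (forall i, root (ad i)) /\
  (forall c, rad (qcomb c) -> forall i, c i = 0) /\
  (forall al, root al -> exists k : 'I_l -> int,
      ((forall i, 0 <= k i) \/ (forall i, k i <= 0)) /\ rad (al - zcomb k)) /\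
  (forall i, wsp (ad i) (e i) /\ wsp (- ad i) (f i) /\
      br (hv (ad i)) (e i) = 2 *: e i /\ br (hv (ad i)) (f i) = - (2 *: f i) /\
      br (e i) (f i) = hv (ad i)).

Definition gdot (x : L) : Prop := gen_subalg (fun y => exists i, y = e i \/ y = f i) x.
Definition Hdot_of (a : 'rV[F]_l) : L := \sum_(i < l) a 0 i *: tv (ad i).
Definition in_Hdot (x : L) : Prop := exists a, x = Hdot_of a.
(** functionals on dot H are given by their values on t_{dotal_i};
    weight space for dot H *)
Definition wspD (nu : 'rV[F]_l) (x : L) : Prop :=
  forall a, br (Hdot_of a) x = (\sum_(i < l) a 0 i * nu 0 i) *: x.
Definition restr (mu : 'rV[F]_n) : 'rV[F]_l := \row_i ev mu (tc (ad i)).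

Definition in_Lsig (s : 'rV[F]_n) (x : L) : Prop :=
  exists ps : seq ('rV[F]_n * L),
    (forall p, p \in ps -> in_Rdot p.1 /\ wsp (p.1 + s) p.2) /\ x = \sum_(p <- ps) p.2.
Definition core_sig (s : 'rV[F]_n) (x : L) : Prop := in_core x /\ in_Lsig s x.
Definition core_wt (nu : 'rV[F]_l) (x : L) : Prop := in_core x /\ wspD nu x.

Definition Rdot_irred_finite_root_system : Prop :=
  (exists s : seq 'rV[F]_n, forall mu, in_Rdot mu <-> mu \in s) /\ in_Rdot 0 /\
  (forall mu nu, in_Rdot mu -> mu != 0 -> in_Rdot nu -> nu != 0 ->
     fdot mu mu != 0 /\
     (exists z : int, 2 * fdot nu mu / fdot mu mu = z%:~R) /\
     in_Rdot (nu - (2 * fdot nu mu / fdot mu mu) *: mu)) /\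
  (forall P : 'rV[F]_n -> Prop,
    (exists mu, in_Rdot mu /\ mu != 0 /\ P mu) ->
    (exists nu, in_Rdot nu /\ nu != 0 /\ ~ P nu) ->
    exists mu nu, in_Rdot mu /\ mu != 0 /\ P mu /\ in_Rdot nu /\ nu != 0 /\ ~ P nu /\
      fdot mu nu != 0).

Definition grading_pair : Prop :=
  (exists m (b : 'I_m -> L), forall x, gdot x <-> exists a : 'I_m -> F, x = \sum_(j < m) a j *: b j) /\
  (exists x y, gdot x /\ gdot y /\ br x y != 0) /\
  (forall I : L -> Prop, (forall x, I x -> gdot x) -> I 0 ->
     (forall a x y, I x -> I y -> I (a *: x + y)) ->
     (forall x y, gdot x -> I y -> I (br x y)) ->
     (forall x, I x -> x = 0) \/ (forall x, gdot x -> I x)) /\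
  (forall x, in_Hdot x -> gdot x) /\ subalg in_Hdot /\
  (exists k, forall (xs : seq L) y, size xs = k -> (forall x, x \in xs -> in_Hdot x) ->
      in_Hdot y -> foldr br y xs = 0) /\
  (forall x, gdot x -> (forall y, in_Hdot y -> in_Hdot (br x y)) -> in_Hdot x) /\
  dsum (fun _ => True) (fun nu x => gdot x /\ wspD nu x) gdot /\
  (forall nu, (exists x, x != 0 /\ gdot x /\ wspD nu x) <-> exists mu, in_Rred mu /\ nu = restr mu).

Definition Rdot_graded : Prop :=
  (forall x, gdot x -> in_core x) /\
  dsum (fun nu => exists mu, in_Rdot mu /\ nu = restr mu) core_wt in_core /\
  (forall x, core_wt 0 x <->
     exists ps : seq ('rV[F]_n * L * L),
       (forall p, p \in ps -> in_Rdot p.1.1 /\ p.1.1 != 0 /\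
          core_wt (restr p.1.1) p.1.2 /\ core_wt (restr (- p.1.1)) p.2) /\
       x = \sum_(p <- ps) br p.1.2 p.2).

Definition Lambda_graded : Prop :=
  dsum in_Lambda core_sig in_core /\
  (forall s t x y, in_Lambda s -> in_Lambda t -> core_sig s x -> core_sig t y ->
      core_sig (s + t) (br x y)) /\
  (forall x, gdot x -> core_sig 0 x) /\
  (forall s, in_Lambda s -> forall P : 'rV[F]_n -> Prop, P 0 ->
     (forall a b, P a -> P b -> P (a - b)) ->
     (forall t, in_Lambda t -> (exists x, x != 0 /\ core_sig t x) -> P t) -> P s).

Definition division : Prop :=
  forall mu, in_Rdot mu -> mu != 0 -> forall s, in_Lambda s ->
  forall x, core_sig s x -> wspD (restr mu) x -> x != 0 ->
  exists y, core_sig (- s) y /\ wspD (restr (- mu)) y /\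
    center_of in_core (br x y - tv mu).

Definition division_graded_core : Prop :=
  Rdot_irred_finite_root_system /\ grading_pair /\ Rdot_graded /\
  Lambda_graded /\ division.

End LieDefs.

(* Main.v *)
(** Write a root as [al], with Cartan integer [<be, al> = 2 (be, al) / (al, al)].
    By T3 and T4 every nonisotropic root lies in an sl2-triple acting locally finitely,
    so root strings and reflections behave as in the finite-dimensional case.
    - An isotropic root not orthogonal to a nonisotropic one would, by the Weyl algebra
      relation [[x, y] = t_de], give an infinite string contradicting integrality; with
      T5b, isotropic roots lie in the radical of the form.
    - For nonisotropic roots of equal norm integrality along strings forces
      [|<be, al>| <= 2]; applied to [al] and its reflection in [be] this gives
      [0 <= <be, al> <al, be> <= 4].  Hence all norms have positive rational ratios,
      and the image of the roots modulo the radical is finite.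
    - Descent on the height by simple reflections reaches every reduced element of [Rdot]
      from the base.  Thus [Rdot_red] consists of roots, and root strings give
      [R <= Rdot + R^0].
    - [gdot] has a triangular decomposition spanned by words in the generators; word
      weights are roots, so [gdot] is finite-dimensional.  Transport by reflections
      identifies its weights with [Rdot_red] and moves any nonzero ideal onto a generator.
    - The core is spanned by nonisotropic root spaces and brackets of two of them whose
      weights cancel modulo the radical; division is T3, because [t_s] is central in the
      core for [s] in [Lambda]. *)

Require Import Defs.
From mathcomp Require Import all_boot all_order all_algebra.
From mathcomp Require Import ssrAC ring zify.
From Stdlib Require Import Classical.
Set Implicit Arguments.
Unset Strict Implicit.
Unset Printing Implicit Defensive.
Import Order.TTheory GRing.Theory Num.Theory.
Local Open Scope ring_scope.

(** * Spanning sets and joint eigenvectors *)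

(** Merges the summands that share a key, so that a list with repeated keys can be replaced by one
    with distinct keys, as [dsum] demands. *)
Lemma sum_by_key (K : eqType) (V : zmodType) (s : seq (K * V)) (q : pred K) :
  \sum_(p <- s | q p.1) p.2 =
  \sum_(k <- undup [seq p.1 | p <- s] | q k) \sum_(p <- s | p.1 == k) p.2.
Proof.
rewrite (exchange_big_dep (fun p : K * V => q p.1)) /=; last first.
  by move=> k p qk /eqP ->.
rewrite big_seq_cond [RHS]big_seq_cond; apply: eq_bigr => p /andP[ps qp].
rewrite (eq_bigl (pred1 p.1)); last first.
  by move=> k; rewrite [p.1 == k]eq_sym /=; case: eqP => [->|_]; rewrite ?qp ?andbF.
rewrite -big_filter filter_pred1_uniq ?undup_uniq ?mem_undup ?map_f //.
by rewrite big_seq1.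
Qed.

Lemma sum_uniq_key (K : eqType) (V : zmodType) (s : seq (K * V)) p :
  uniq (map fst s) -> p \in s -> \sum_(q <- s | q.1 == p.1) q.2 = p.2.
Proof.
move=> us ps; rewrite -big_filter.
suff -> : [seq q <- s | q.1 == p.1] = [:: p] by rewrite big_seq1.
elim: s us ps => //= q s IHs /andP[nq us].
rewrite inE => /orP[/eqP ->|ps].
  rewrite eqxx; congr (_ :: _); apply/eqP.
  rewrite -size_eq0 size_filter -leqn0 leqNgt -has_count.
  by apply/hasP => -[r rs /eqP E]; case/negP: nq; rewrite -E map_f.
by case: eqP => [E|_]; [case/negP: nq; rewrite E map_f | apply: IHs].
Qed.

Section AddSpan.
Variables (F : fieldType) (L : lmodType F).

(** Sums without coefficients; this is a linear span as soon as [S] is stable under scaling. The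
    inductive form allows induction on the summands. *)
Inductive addspan (S : L -> Prop) : L -> Prop :=
| addspan0 : addspan S 0
| addspan_cons x y : S x -> addspan S y -> addspan S (x + y).

Lemma addspan_in (S : L -> Prop) x : S x -> addspan S x.
Proof. by move=> Sx; rewrite -[x]addr0; do 2?constructor. Qed.

Lemma addspanD (S : L -> Prop) x y : addspan S x -> addspan S y -> addspan S (x + y).
Proof. by elim=> [|a b Sa _ IH] Sy; rewrite ?add0r // -addrA; constructor=> //; apply: IH. Qed.

Lemma addspan_sub (S S' : L -> Prop) x :
  (forall y, S y -> addspan S' y) -> addspan S x -> addspan S' x.
Proof. by move=> sub; elim=> [|a b Sa _ IH]; [constructor | apply: addspanD; auto]. Qed.

Lemma addspanZ (S : L -> Prop) a x :
  (forall b y, S y -> S (b *: y)) -> addspan S x -> addspan S (a *: x).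
Proof.
by move=> SZ; elim=> [|y z Sy _ IH]; rewrite ?scaler0 ?scalerDr; constructor; auto.
Qed.

Lemma finite_span (T : finType) (v : T -> L) (V : L -> Prop) :
  (forall x, V x <-> addspan (fun y => exists a t, y = a *: v t) x) ->
  exists m (b : 'I_m -> L), forall x,
    V x <-> exists a : 'I_m -> F, x = \sum_(j < m) a j *: b j.
Proof.
move=> Vspan; exists #|T|, (fun j => v (enum_val j)) => x; rewrite Vspan; split.
  elim=> [|_ z [c [t ->]] _ [a ->]].
    by exists (fun _ => 0); rewrite big1 // => j _; rewrite scale0r.
  (* Repeated occurrences of [t] accumulate in its coefficient. *)
  exists (fun j => (if j == enum_rank t then c else 0) + a j).
  under [RHS]eq_bigr => j _ do rewrite scalerDl.
  rewrite big_split /=; congr (_ + _).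
  rewrite (bigD1 (enum_rank t)) //= eqxx enum_rankK big1 ?addr0 // => j /negPf ->.
  by rewrite scale0r.
move=> [a ->]; elim/big_ind: _ => [||j _]; first by constructor.
  exact: addspanD.
by apply: addspan_in; exists (a j), (enum_val j).
Qed.

Lemma addspan_keyed (K : eqType) (P : K -> L -> Prop) x :
  addspan (fun y => exists k, P k y) x ->
  exists s : seq (K * L), (forall p, p \in s -> P p.1 p.2) /\ x = \sum_(p <- s) p.2.
Proof.
elim=> [|y z [k Pk] _ [s [Ps ->]]]; first by exists [::]; rewrite big_nil.
exists ((k, y) :: s); rewrite big_cons; split=> // p.
by rewrite inE => /orP[/eqP -> //|]; apply: Ps.
Qed.

Lemma keyed_addspan (K : eqType) (P : K -> L -> Prop) (s : seq (K * L)) :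
  (forall p, p \in s -> P p.1 p.2) ->
  addspan (fun y => exists k, P k y) (\sum_(p <- s) p.2).
Proof.
elim: s => [|p s IH] Ps; first by rewrite big_nil; constructor.
rewrite big_cons; constructor; first by exists p.1; apply: Ps; rewrite mem_head.
by apply: IH => q qs; apply: Ps; rewrite inE qs orbT.
Qed.

(** The spanning condition may be checked with repeated indices: as each [P k] is additive, summands
    of equal index are merged. *)
Lemma dsumI (K : eqType) (I : K -> Prop) (P : K -> L -> Prop) (V : L -> Prop) :
  (forall k, P k 0) -> (forall k x y, P k x -> P k y -> P k (x + y)) ->
  (forall x, V x -> addspan (fun y => exists k, I k /\ P k y) x) ->
  (forall s : seq (K * L), uniq (map fst s) ->
      (forall p, p \in s -> I p.1 /\ P p.1 p.2) ->
      \sum_(p <- s) p.2 = 0 -> forall p, p \in s -> p.2 = 0) ->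
  dsum I P V.
Proof.
move=> P0 PD span ind; split=> // x /span /addspan_keyed [s [Ps ->]].
exists [seq (k, \sum_(p <- s | p.1 == k) p.2) | k <- undup [seq p.1 | p <- s]].
split; first by rewrite -map_comp map_id undup_uniq.
split; last by rewrite big_map (sum_by_key s predT).
move=> p0 /mapP[k]; rewrite mem_undup => /mapP[q qs kq] {p0}-> /=.
split; first by rewrite kq; case: (Ps q qs).
rewrite big_seq_cond; apply: (big_ind (P k)) => [||p /andP[ps /eqP <-]] //; first exact: PD.
by case: (Ps p ps).
Qed.

End AddSpan.

(** * The bracket and generated subalgebras *)

Section LieBasics.
Variables (F : fieldType) (L : lmodType F) (br : L -> L -> L).
Hypothesis lie : lie_bracket br.

Lemma brDl x y z : br (x + y) z = br x z + br y z.
Proof. by case: lie => H _; rewrite -[x]scale1r H !scale1r. Qed.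
Lemma brDr x y z : br z (x + y) = br z x + br z y.
Proof. by case: lie => _ [H _]; rewrite -[x]scale1r H !scale1r. Qed.
Lemma br0l z : br 0 z = 0.
Proof. by apply: (addrI (br 0 z)); rewrite -brDl !addr0. Qed.
Lemma br0r z : br z 0 = 0.
Proof. by apply: (addrI (br z 0)); rewrite -brDr !addr0. Qed.
Lemma brZl a x z : br (a *: x) z = a *: br x z.
Proof. by case: lie => H _; rewrite -[a *: x]addr0 H br0l addr0. Qed.
Lemma brZr a x z : br z (a *: x) = a *: br z x.
Proof. by case: lie => _ [H _]; rewrite -[a *: x]addr0 H br0r addr0. Qed.
Lemma brNl x z : br (- x) z = - br x z.
Proof. by rewrite -scaleN1r brZl scaleN1r. Qed.
Lemma brNr x z : br z (- x) = - br z x.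
Proof. by rewrite -scaleN1r brZr scaleN1r. Qed.
Lemma br_suml (I : Type) (r : seq I) (P : pred I) (f : I -> L) z :
  br (\sum_(i <- r | P i) f i) z = \sum_(i <- r | P i) br (f i) z.
Proof. by elim/big_rec2: _ => [|i x y _ <-]; rewrite ?br0l ?brDl. Qed.
Lemma br_sumr (I : Type) (r : seq I) (P : pred I) (f : I -> L) z :
  br z (\sum_(i <- r | P i) f i) = \sum_(i <- r | P i) br z (f i).
Proof. by elim/big_rec2: _ => [|i x y _ <-]; rewrite ?br0r ?brDr. Qed.
Lemma brxx x : br x x = 0.
Proof. by case: lie => _ [_ [H _]]. Qed.
Lemma br_anti x y : br x y = - br y x.
Proof.
apply/eqP; rewrite -addr_eq0; apply/eqP.
by have := brxx (x + y); rewrite brDl !brDr !brxx add0r addr0.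
Qed.
Lemma br_jacobi x y z : br x (br y z) = br (br x y) z + br y (br x z).
Proof.
case: lie => _ [_ [_ H]]; have := H x y z.
rewrite [br z (br x y)]br_anti [br z x]br_anti brNr => /eqP.
by rewrite subr_eq0 subr_eq => /eqP ->.
Qed.

Lemma gen_subalg_sub (S P : L -> Prop) x :
  P 0 -> (forall a x y, P x -> P y -> P (a *: x + y)) -> (forall y, S y -> P y) ->
  (forall y z, S y -> P z -> P (br y z)) -> gen_subalg br S x -> P x.
Proof.
(* [P] is stable under the generators, hence under everything they generate. *)
move=> P0 PL SP SbP gx.
have PD y z : P y -> P z -> P (y + z) by move=> Py Pz; rewrite -[y]scale1r; apply: PL.
have PZ a y : P y -> P (a *: y) by move=> Py; rewrite -[_ *: _]addr0; apply: PL.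
have [] // : P x /\ forall z, P z -> P (br x z).
apply: (gx (fun y => P y /\ forall z, P z -> P (br y z))) => [|y Sy].
  2: by split; [exact: SP | move=> z; exact: SbP].
split; first by split=> [|z _]; rewrite ?br0l.
split=> [a y z [Py Hy] [Pz Hz]|y z [Py Hy] [Pz Hz]].
  by split=> [|w Pw]; [exact: PL | rewrite brDl brZl; apply: PL; auto].
split=> [|w Pw]; first exact: Hy.
have -> : br (br y z) w = br y (br z w) - br z (br y w) by rewrite (br_jacobi y z w) addrK.
by apply: PD; [auto | rewrite -scaleN1r; apply: PZ; auto].
Qed.

Lemma gen_subalg_in (S : L -> Prop) x : S x -> gen_subalg br S x.
Proof. by move=> Sx P _; apply. Qed.
Lemma subalg_gen (S : L -> Prop) : subalg br (gen_subalg br S).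
Proof.
split; first by move=> P [P0 _] _.
split=> [a x y gx gy|x y gx gy] P sP SP; have [_ [PL Pb]] := sP.
  by apply: PL; [apply: gx | apply: gy].
by apply: Pb; [apply: gx | apply: gy].
Qed.

Section Subalg.
Variable P : L -> Prop.
Hypothesis sP : subalg br P.
Lemma subalg0 : P 0. Proof. by case: sP. Qed.
Lemma subalgL a x y : P x -> P y -> P (a *: x + y).
Proof. by case: sP => _ []; auto. Qed.
Lemma subalg_br x y : P x -> P y -> P (br x y).
Proof. by case: sP => _ []; auto. Qed.
Lemma subalgD x y : P x -> P y -> P (x + y).
Proof. by move=> Px Py; rewrite -[x]scale1r; apply: subalgL. Qed.
Lemma subalgZ a x : P x -> P (a *: x).
Proof. by move=> Px; rewrite -[_ *: _]addr0; apply: subalgL => //; apply: subalg0. Qed.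
Lemma subalg_sum (I : eqType) (r : seq I) (Q : pred I) (f : I -> L) :
  (forall i, i \in r -> Q i -> P (f i)) -> P (\sum_(i <- r | Q i) f i).
Proof.
move=> H; rewrite big_seq_cond; apply: (big_ind P) => [||i /andP[]]; first exact: subalg0.
  exact: subalgD.
exact: H.
Qed.
Lemma addspan_subalg (S : L -> Prop) x : (forall y, S y -> P y) -> addspan S x -> P x.
Proof. by move=> SP; elim=> [|y z Sy _]; [exact: subalg0 | apply: subalgD; auto]. Qed.
End Subalg.

(** * Joint eigenvectors and their independence *)

Section Eigen.
Variables (m : nat) (H : 'rV[F]_m -> L).
Implicit Types (al be c : 'rV[F]_m).

(** The family [H] is arbitrary, so that one set of lemmas serves both [wsp] (with [hvec]) and
    [wspD] (with [Hdot_of]). *)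
Definition eigenvec al x := forall c, br (H c) x = ev al c *: x.

Lemma evDl al be c : ev (al + be) c = ev al c + ev be c.
Proof. by rewrite -big_split; apply: eq_bigr => i _; rewrite mxE mulrDl. Qed.
Lemma evZl a al c : ev (a *: al) c = a * ev al c.
Proof. by rewrite mulr_sumr; apply: eq_bigr => i _; rewrite mxE mulrA. Qed.
Lemma evC al c : ev al c = ev c al.
Proof. by apply: eq_bigr => i _; rewrite mulrC. Qed.
Lemma ev0l c : ev 0 c = 0.
Proof. by apply: big1 => i _; rewrite mxE mul0r. Qed.
Lemma ev_delta al i : ev al (delta_mx 0 i) = al 0 i.
Proof.
rewrite /ev (bigD1 i) //= big1 => [|j /negPf ji]; rewrite !mxE ?eqxx ?ji ?mulr0 //.
by rewrite mulr1 addr0.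
Qed.
Lemma ev_inj al be : (forall c, ev al c = ev be c) -> al = be.
Proof. by move=> E; apply/rowP => i; rewrite -!ev_delta E. Qed.
Lemma ev_sep al be : al != be -> exists c, ev al c != ev be c.
Proof.
move=> ne; apply: NNPP => nex; case/eqP: ne; apply: ev_inj => c; apply/eqP.
by apply: contraT => nc; case: nex; exists c.
Qed.

Lemma eigen0 al : eigenvec al 0.
Proof. by move=> c; rewrite br0r scaler0. Qed.
Lemma eigenD al x y : eigenvec al x -> eigenvec al y -> eigenvec al (x + y).
Proof. by move=> Hx Hy c; rewrite brDr Hx Hy scalerDr. Qed.
Lemma eigenZ al a x : eigenvec al x -> eigenvec al (a *: x).
Proof. by move=> Hx c; rewrite brZr Hx !scalerA mulrC. Qed.
Lemma eigenN al x : eigenvec al x -> eigenvec al (- x).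
Proof. by rewrite -scaleN1r; apply: eigenZ. Qed.
Lemma eigen_sum al (I : eqType) (r : seq I) (Q : pred I) (f : I -> L) :
  (forall i, i \in r -> Q i -> eigenvec al (f i)) -> eigenvec al (\sum_(i <- r | Q i) f i).
Proof.
move=> E; rewrite big_seq_cond; apply: (big_ind (eigenvec al)) => [||i /andP[]].
- exact: eigen0.
- by move=> x y; apply: eigenD.
exact: E.
Qed.
Lemma eigen_br al be x y : eigenvec al x -> eigenvec be y -> eigenvec (al + be) (br x y).
Proof. by move=> Hx Hy c; rewrite br_jacobi Hx Hy brZl brZr -scalerDl evDl. Qed.
Lemma eigen_uniq al be x : x != 0 -> eigenvec al x -> eigenvec be x -> al = be.
Proof.
move=> nx Hx Hy; apply: ev_inj => c; apply/eqP; rewrite -subr_eq0.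
have := congr1 (fun z => z - ev be c *: x) (Hx c).
rewrite /= {1}Hy subrr -scalerBl => /esym/eqP; rewrite scaler_eq0 (negPf nx) orbF.
by [].
Qed.

Section Component.
Variable I : L -> Prop.
Hypothesis IL : forall a x y, I x -> I y -> I (a *: x + y).
Hypothesis IH : forall c x, I x -> I (br (H c) x).

(** Take [c] separating [al] from [be] and apply [ad (H c) - ev be c]: the summand of weight [be]
    disappears, [x] is multiplied by a nonzero scalar and the other summands are rescaled. As those
    vectors change, the induction is on the length of the list. *)
Lemma eigen_split al x (s : seq ('rV[F]_m * L)) :
  eigenvec al x -> (forall p, p \in s -> p.1 != al /\ eigenvec p.1 p.2) ->
  I (x + \sum_(p <- s) p.2) -> I x.
Proof.
elim: {s}(size s) {-2}s (erefl (size s)) => [|N IHN] [|[be y] s] //=.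
  by move=> _ _ _; rewrite big_nil addr0.
move=> [sN] Ex Es Ixs.
have [] := Es (be, y) (mem_head _ _) => /= nbe Ey.
have [c nc] : exists c, ev al c != ev be c by apply: ev_sep; rewrite eq_sym.
have nc0 : ev al c - ev be c != 0 by rewrite subr_eq0.
pose s' := [seq (p.1, ((ev al c - ev be c)^-1 * (ev p.1 c - ev be c)) *: p.2) | p <- s].
apply: (IHN s'); rewrite ?size_map //.
  move=> _ /mapP[p ps ->] /=; have [] := Es p; first by rewrite inE ps orbT.
  by move=> np Ep; split=> //; apply: eigenZ.
have I0 : I 0.
  set z := x + _ in Ixs; suff -> : 0 = -1 *: z + z by apply: IL.
  by rewrite scaleN1r addNr.
set z := x + \sum_(p <- (be, y) :: s) p.2 in Ixs.
have -> : x + \sum_(p <- s') p.2 =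
    (ev al c - ev be c)^-1 *: (- ev be c *: z + br (H c) z) + 0; last first.
  by apply: IL => //; apply: IL => //; apply: IH.
have Es' : br (H c) (\sum_(p <- s) p.2) = \sum_(p <- s) ev p.1 c *: p.2.
  rewrite br_sumr; apply: eq_big_seq => p ps.
  by have [] := Es p; [rewrite inE ps orbT | move=> _ ->].
rewrite addr0 /z big_cons /= !brDr Ex Ey Es'.
transitivity ((ev al c - ev be c)^-1 *: ((ev al c - ev be c) *: x +
    \sum_(p <- s) (ev p.1 c - ev be c) *: p.2)).
  rewrite scalerDr scalerA mulVf // scale1r big_map scaler_sumr; congr (_ + _).
  by apply: eq_bigr => p _; rewrite scalerA.
congr (_ *: _); rewrite (eq_bigr (fun p => ev p.1 c *: p.2 - ev be c *: p.2)) => [|p _]; last first.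
  by rewrite scalerBl.
rewrite sumrB -scaler_sumr !scalerDr !scaleNr scalerBl.
move: (ev al c *: x) (ev be c *: x) (ev be c *: y) (ev be c *: _) (\sum_(p <- s) _) => a b g w k.
by rewrite [RHS](AC ((1*2)*(1*2)) (((4*1)*(6*3))*(5*2))) /= subrr addr0.
Qed.

Lemma eigen_component (s : seq ('rV[F]_m * L)) :
  (forall p, p \in s -> eigenvec p.1 p.2) -> I (\sum_(p <- s) p.2) ->
  forall al, I (\sum_(p <- s | p.1 == al) p.2).
Proof.
move=> Es Is al; apply: (@eigen_split al _ [seq p <- s | p.1 != al]).
- by apply: eigen_sum => p ps /eqP <-; apply: Es.
- by move=> p; rewrite mem_filter => /andP[-> ps]; split=> //; apply: Es.
by rewrite big_filter; move: Is; rewrite (bigID (fun p => p.1 == al)).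
Qed.

Lemma eigen_component_uniq (s : seq ('rV[F]_m * L)) :
  uniq (map fst s) -> (forall p, p \in s -> eigenvec p.1 p.2) ->
  I (\sum_(p <- s) p.2) -> forall p, p \in s -> I p.2.
Proof.
move=> us Es Is p ps; rewrite -(sum_uniq_key us ps).
exact: eigen_component.
Qed.
End Component.

(** This is [eigen_component] for the zero subspace. A general [q] selects several weights at once,
    as the independence of the [Lambda]-grading requires. *)
Lemma eigen_indep (s : seq ('rV[F]_m * L)) :
  (forall p, p \in s -> eigenvec p.1 p.2) -> \sum_(p <- s) p.2 = 0 ->
  forall q : pred 'rV[F]_m, \sum_(p <- s | q p.1) p.2 = 0.
Proof.
move=> Es s0 q; rewrite sum_by_key; apply: big1 => k _.
apply: (@eigen_component (fun x => x = 0)) Es s0 k => [a x y -> ->|c x ->].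
  by rewrite scaler0 addr0.
by rewrite br0r.
Qed.

Lemma eigen_addspan (S : L -> Prop) al x :
  (forall y, S y -> exists be, eigenvec be y) -> addspan S x -> eigenvec al x ->
  addspan (fun y => S y /\ eigenvec al y) x.
Proof.
move=> Sw Sx Ex.
have [s [sP xE]] : exists s : seq ('rV[F]_m * L),
    (forall p, p \in s -> S p.2 /\ eigenvec p.1 p.2) /\ x = \sum_(p <- s) p.2.
  apply: (addspan_keyed (P := fun be y => S y /\ eigenvec be y)).
  by apply: addspan_sub Sx => y Sy; have [be Ey] := Sw y Sy; apply: addspan_in; exists be.
(* With [- x] as one more vector of weight [al], the expansion of [x] becomes a vanishing sum, whose
   part of weight [al] vanishes too. *)
have Es : forall p, p \in (al, - x) :: s -> eigenvec p.1 p.2.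
  by move=> p; rewrite inE => /orP[/eqP ->|/sP[]//]; apply: eigenN.
have s0 : \sum_(p <- (al, - x) :: s) p.2 = 0 by rewrite big_cons /= xE addNr.
have := eigen_indep Es s0 (pred1 al).
rewrite big_cons /= eqxx => /eqP; rewrite addrC subr_eq0 => /eqP <-.
elim: s sP {xE Es s0} => [|p s IH] sP; first by rewrite big_nil; constructor.
have IH' := IH (fun q qs => sP q (mem_behead (s := p :: s) qs)).
rewrite big_cons; case: eqP => // E; constructor=> //.
by rewrite -E; apply: sP; rewrite mem_head.
Qed.
End Eigen.
End LieBasics.

(** * Strings for sl2-triples *)

Lemma intdvd_le (w d r : int) : r = w * d -> r != 0 -> `|d| <= `|r|.
Proof.
move=> -> nz; rewrite normrM ler_peMl ?normr_ge0 //.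
by case: (eqVneq w 0) nz => [->|]; [rewrite mul0r | lia].
Qed.

Section Sl2.
Variables (F : fieldType) (L : lmodType F) (br : L -> L -> L).
Hypotheses (char0 : [pchar F] =i pred0) (lie : lie_bracket br).

Lemma natF_eq0 k : ((k%:R : F) == 0) = (k == 0%N).
Proof. by move/pcharf0P: char0. Qed.
Lemma intF_eq0 (z : int) : ((z%:~R : F) == 0) = (z == 0).
Proof. by case: z => k; rewrite ?NegzE ?mulrNz ?oppr_eq0 -pmulrn natF_eq0. Qed.
Lemma intF_inj (y z : int) : (y%:~R : F) = z%:~R -> y = z.
Proof.
by move/eqP; rewrite -subr_eq0 -intrB intF_eq0 subr_eq0 => /eqP.
Qed.

(** [ratr] is defined by the reduced fraction; in characteristic 0 any other fraction computes it as
    well, which gives additivity. *)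
Lemma ratF_frac (q : rat) (a b : int) : b != 0 -> q * b%:~R = a%:~R ->
  (ratr q : F) = a%:~R / b%:~R.
Proof.
move=> b0 qE; apply/eqP; rewrite /ratr eqr_div ?intF_eq0 ?denq_neq0 //.
rewrite -!intrM; apply/eqP; congr (_%:~R); apply: (@intr_inj rat).
by rewrite !intrM numqE mulrAC qE.
Qed.
Lemma ratF_int (z : int) : (ratr z%:~R : F) = z%:~R.
Proof. by rewrite (@ratF_frac _ z 1) ?divr1 ?mulr1. Qed.
Lemma ratFB (c d : rat) : (ratr (c - d) : F) = ratr c - ratr d.
Proof.
rewrite (@ratF_frac _ (numq c * denq d - numq d * denq c) (denq c * denq d)).
- by rewrite /ratr; field; rewrite !intF_eq0 !denq_neq0.
- by rewrite mulf_neq0 ?denq_neq0.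
by rewrite intrB !intrM !numqE; ring.
Qed.

Variables (e f t : L).
Hypotheses (te : br t e = 2 *: e) (tf : br t f = - (2 *: f)) (ef : br e f = t).
Hypotheses (enil : forall y, exists k, iter k (br e) y = 0)
  (fnil : forall y, exists k, iter k (br f) y = 0).

Lemma sl2_weight v m k : br t v = m *: v ->
  br t (iter k (br f) v) = (m - (2 * k)%:R) *: iter k (br f) v.
Proof.
move=> tv; elim: k => [|k IH] /=; first by rewrite subr0.
rewrite (br_jacobi lie) tf IH (brNl lie) (brZl lie) (brZr lie) -scaleNr -scalerDl.
by congr (_ *: _); rewrite mulnS natrD; ring.
Qed.
Lemma sl2_weight_e v m k : br t v = m *: v ->
  br t (iter k (br e) v) = (m + (2 * k)%:R) *: iter k (br e) v.
Proof.
move=> tv; elim: k => [|k IH] /=; first by rewrite addr0.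
rewrite (br_jacobi lie) te IH (brZl lie) (brZr lie) -scalerDl.
by congr (_ *: _); rewrite mulnS natrD; ring.
Qed.

(** The classical formula for a highest weight vector [v] of weight [m]. *)
Lemma sl2_lower v m k : br e v = 0 -> br t v = m *: v ->
  br e (iter k.+1 (br f) v) = (k.+1%:R * (m - k%:R)) *: iter k (br f) v.
Proof.
move=> ev0 tv; elim: k => [|k IH].
  by rewrite /= (br_jacobi lie) ev0 (br0r lie) addr0 ef tv mul1r subr0.
rewrite iterS (br_jacobi lie) ef (sl2_weight _ tv) IH (brZr lie) -iterS -scalerDl.
by congr (_ *: _); rewrite natrM -[k.+2]add2n -[k.+1]add1n !natrD; ring.
Qed.

Lemma nilp_last (g : L -> L) v : v != 0 -> (exists k, iter k g v = 0) ->
  exists k, iter k.+1 g v = 0 /\ forall j, (j <= k)%N -> iter j g v != 0.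
Proof.
move=> v0 [k0 gk0]; have ex : exists k, iter k g v == 0 by exists k0; apply/eqP.
case: (ex_minnP ex) => -[|k] /eqP gk kmin; first by rewrite -gk eqxx in v0.
exists k; split=> // j jk; apply/negP => /kmin; by rewrite ltnNge jk.
Qed.

(** Climb [k] steps with [e] to a nonzero vector killed by [e], then descend with [f] to the last
    nonzero vector, after [p] steps. By [sl2_lower] the top weight [c + 2 k] equals [p]. The stable
    predicate [M] keeps the string inside a subalgebra or an ideal. *)
Lemma sl2_string (M : L -> Prop) v c :
  (forall x, M x -> M (br e x)) -> (forall x, M x -> M (br f x)) ->
  M v -> v != 0 -> br t v = c *: v ->
  exists k p : nat, c = p%:R - (2 * k)%:R /\
    forall j, (j <= p)%N -> M (iter j (br f) (iter k (br e) v)) /\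
                       iter j (br f) (iter k (br e) v) != 0.
Proof.
move=> Me Mf Mv v0 tv.
have [k [ek kmin]] := nilp_last v0 (enil v).
have [p [fp pmin]] := nilp_last (kmin k (leqnn k)) (fnil _).
exists k, p; split; last first.
  move=> j jp; split; last exact: pmin.
  have : M (iter k (br e) v) by elim: (k) => //= i; apply: Me.
  by move: (iter k _ v) => w Mw; elim: (j) => //= i; apply: Mf.
have := sl2_lower p ek (sl2_weight_e k tv).
rewrite fp (br0r lie) => /esym/eqP; rewrite scaler_eq0 (negPf (pmin p (leqnn p))) orbF.
by rewrite mulf_eq0 natF_eq0 /= subr_eq0 => /eqP <-; rewrite addrK.
Qed.
End Sl2.

(** * Roots *)

Section ClassT.
Variables (F : fieldType) (L : lmodType F) (br : L -> L -> L) (B : L -> L -> F).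
Variables (n : nat) (h : 'I_n -> L).
Hypothesis HT : class_T br B h.
Implicit Types (al be de c : 'rV[F]_n) (x y : L).

Lemma T_char0 : [pchar F] =i pred0. Proof. by case: HT. Qed.
Lemma T_lie : lie_bracket br. Proof. by case: HT => _ []. Qed.
Let lie := T_lie.
Let char0 := T_char0.

Let form : nondeg_sym_inv_form br B. Proof. by case: HT => _ [_ []]. Qed.
Let toral : toral_basis br h. Proof. by case: HT => _ [_ [_ []]]. Qed.
Let formH : form_nondeg_on_H B h. Proof. by case: HT => _ [_ [_ [_ []]]]. Qed.
Let t3 : T3 br B h. Proof. by case: HT => _ [_ [_ [_ [_ []]]]]. Qed.
Let t4 : T4 br B h. Proof. by case: HT => _ [_ [_ [_ [_ [_ []]]]]]. Qed.
Let t5a : T5a br B h. Proof. by case: HT => _ [_ [_ [_ [_ [_ [_ []]]]]]]. Qed.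
Let t5b : T5b br B h. Proof. by case: HT => _ [_ [_ [_ [_ [_ [_ [_ []]]]]]]]. Qed.

Notation hvec := (hvec h).
Notation wsp := (wsp br h).
Notation tc := (tc B h).
Notation tv := (tv B h).
Notation fdot := (fdot B h).
Notation root := (Defs.root br h).
Notation root_x := (root_x br B h).
Notation root_0 := (root_0 br B h).
Notation rad := (Defs.rad br B h).
Notation hv := (hv B h).
Notation G := (gram B h).

Lemma BC x y : B x y = B y x. Proof. by case: form => _ []. Qed.
Lemma B_suml (I : Type) (r : seq I) (a : I -> F) (f : I -> L) y :
  B (\sum_(i <- r) a i *: f i) y = \sum_(i <- r) a i * B (f i) y.
Proof.
have [BL _] := form.
have B0 : B 0 y = 0.
  by apply: (addrI (B 0 y)); have := BL 1 0 0 y; rewrite scaler0 !addr0 mul1r => {1}<-.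
by elim: r => [|i r IH]; rewrite ?big_nil // !big_cons BL IH.
Qed.

Lemma hvecL a c d : hvec (a *: c + d) = a *: hvec c + hvec d.
Proof.
rewrite scaler_sumr -big_split; apply: eq_bigr => i _.
by rewrite !mxE scalerDl scalerA.
Qed.
Lemma hvecZ a c : hvec (a *: c) = a *: hvec c.
Proof. by rewrite scaler_sumr; apply: eq_bigr => i _; rewrite !mxE scalerA. Qed.

Lemma B_hvec c d : B (hvec c) (hvec d) = ev (c *m G) d.
Proof.
rewrite B_suml; under eq_bigr => i _ do rewrite BC B_suml mulr_sumr.
rewrite exchange_big; apply: eq_bigr => j _; rewrite mxE mulr_suml.
by apply: eq_bigr => i _; rewrite mxE BC mulrCA mulrC.
Qed.

Lemma gram_unit : G \in unitmx.
Proof.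
rewrite unitmxE unitfE; apply/negP => /det0P[v v0 vG].
case/eqP: v0; have [inj _] := toral; apply: inj; apply: formH => d.
by rewrite B_hvec vG ev0l.
Qed.

Lemma B_tv al c : B (tv al) (hvec c) = ev al c.
Proof. by rewrite B_hvec mulmxKV ?gram_unit. Qed.
Lemma fdotE al be : fdot al be = ev al (tc be). Proof. exact: B_tv. Qed.
Lemma fdotC al be : fdot al be = fdot be al. Proof. exact: BC. Qed.
Lemma fdotDl al be de : fdot (al + be) de = fdot al de + fdot be de.
Proof. by rewrite !fdotE evDl. Qed.
Lemma fdotZl a al de : fdot (a *: al) de = a * fdot al de.
Proof. by rewrite !fdotE evZl. Qed.
Lemma fdot0l de : fdot 0 de = 0. Proof. by rewrite fdotE ev0l. Qed.
Lemma fdotNl al de : fdot (- al) de = - fdot al de.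
Proof. by rewrite -scaleN1r fdotZl mulN1r. Qed.
Lemma fdotBl al be de : fdot (al - be) de = fdot al de - fdot be de.
Proof. by rewrite fdotDl fdotNl. Qed.
Lemma fdotMl al z de : fdot (al *~ z) de = z%:~R * fdot al de.
Proof. by rewrite -scaler_int fdotZl. Qed.
Lemma fdotMnl al k de : fdot (al *+ k) de = k%:R * fdot al de.
Proof. by rewrite -scaler_nat fdotZl. Qed.
Lemma fdotDr al be de : fdot de (al + be) = fdot de al + fdot de be.
Proof. by rewrite ![fdot de _]fdotC fdotDl. Qed.
Lemma fdotZr a al de : fdot de (a *: al) = a * fdot de al.
Proof. by rewrite ![fdot de _]fdotC fdotZl. Qed.
Lemma fdotNr al de : fdot de (- al) = - fdot de al.
Proof. by rewrite ![fdot de _]fdotC fdotNl. Qed.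
Lemma fdotBr al be de : fdot de (al - be) = fdot de al - fdot de be.
Proof. by rewrite fdotDr fdotNr. Qed.
Lemma fdotMr al z de : fdot de (al *~ z) = z%:~R * fdot de al.
Proof. by rewrite ![fdot de _]fdotC fdotMl. Qed.
Lemma fdotMnr al k de : fdot de (al *+ k) = k%:R * fdot de al.
Proof. by rewrite ![fdot de _]fdotC fdotMnl. Qed.
Lemma fdot_suml (I : Type) (r : seq I) (P : pred I) (f : I -> 'rV[F]_n) de :
  fdot (\sum_(i <- r | P i) f i) de = \sum_(i <- r | P i) fdot (f i) de.
Proof. by elim/big_rec2: _ => [|i x y _ <-]; rewrite ?fdot0l ?fdotDl. Qed.

Lemma tvL a al be : tv (a *: al + be) = a *: tv al + tv be.
Proof. by rewrite -hvecL /tv /Defs.tc mulmxDl scalemxAl. Qed.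
Lemma tvD al be : tv (al + be) = tv al + tv be.
Proof. by rewrite -[al]scale1r tvL !scale1r. Qed.
Lemma tvN al : tv (- al) = - tv al.
Proof. by rewrite /tv /Defs.tc mulNmx -[- (al *m _)]scaleN1r hvecZ scaleN1r. Qed.
Lemma tv_eq0 al : tv al = 0 -> al = 0.
Proof.
move=> tv0; apply: ev_inj => c; rewrite ev0l -B_tv tv0.
have := B_suml [::] (fun _ : unit => 0) (fun _ => 0) (hvec c).
by rewrite !big_nil.
Qed.

Lemma wsp_tv al be x : wsp be x -> br (tv al) x = fdot be al *: x.
Proof. by move=> ->; rewrite fdotE. Qed.
Lemma wsp_hv al be x : wsp be x -> br (hv al) x = (2 * fdot be al / fdot al al) *: x.
Proof.
by move=> wx; rewrite /hv wx evC evZl evC -fdotE mulrAC.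
Qed.
Lemma hvE al : hv al = (2 / fdot al al) *: tv al.
Proof. by rewrite -hvecZ. Qed.

Lemma wsp_decomp x : exists s : seq ('rV[F]_n * L), uniq (map fst s) /\
  (forall p, p \in s -> wsp p.1 p.2) /\ x = \sum_(p <- s) p.2.
Proof.
case: toral => _ [_ [_ [D _]]]; have [s [us [Hs ->]]] := D x I.
by exists s; split=> //; split=> // p /Hs [].
Qed.

Lemma wsp_iter al be x v k : wsp al x -> wsp be v -> wsp (be + al *+ k) (iter k (br x) v).
Proof.
move=> wx wv; elim: k => [|k IH] /=; first by rewrite addr0.
by rewrite mulrS addrCA; apply: (eigen_br lie).
Qed.

Lemma hvec_comm c d : br (hvec c) (hvec d) = 0.
Proof.
(* [ad (hvec d)] is diagonalizable and squares to zero on [hvec c]. *)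
have zero0 a x y : x = 0 -> y = 0 -> a *: x + y = 0 :> L.
  by move=> -> ->; rewrite scaler0 addr0.
have br0 b x : x = 0 -> br (hvec b) x = 0 by move=> ->; rewrite (br0r lie).
have scaled (s : seq ('rV[F]_n * L)) (g : 'rV[F]_n -> F) : uniq (map fst s) ->
    (forall p, p \in s -> wsp p.1 p.2) -> \sum_(p <- s) g p.1 *: p.2 = 0 ->
    forall p, p \in s -> g p.1 *: p.2 = 0.
  move=> us ws s0 p ps; pose s' := [seq (p.1, g p.1 *: p.2) | p <- s].
  apply: (eigen_component_uniq lie (H := hvec) zero0 br0 (s := s') _ _ _ (map_f _ ps)).
  - by rewrite -map_comp.
  - by move=> _ /mapP[q qs ->]; apply: (eigenZ lie); apply: ws.
  by rewrite big_map.
have [s [us [ws sE]]] := wsp_decomp (hvec d).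
have dW p : p \in s -> br (hvec d) p.2 = 0.
  move=> ps; rewrite ws //; apply: (scaled s (fun al => ev al d)) => //.
  rewrite -[RHS](brxx lie (hvec d)) {2}sE (br_sumr lie).
  by apply: eq_big_seq => q qs; rewrite ws.
have dd : br (hvec d) (br (hvec d) (hvec c)) = 0.
  rewrite [br _ (hvec c)](br_anti lie) {2}sE (br_sumr lie) (brNr lie) (br_sumr lie).
  rewrite big_seq big1 ?oppr0 // => p ps.
  by rewrite ws // (brZr lie) dW // scaler0.
rewrite (br_anti lie).
have [s2 [us2 [ws2 s2E]]] := wsp_decomp (hvec c).
rewrite s2E (br_sumr lie) big_seq big1 ?oppr0 // => p ps; rewrite ws2 //.
have := scaled s2 (fun al => ev al d * ev al d) us2 ws2 _ p ps.
case: (eqVneq (ev p.1 d) 0) => [-> _|nz H]; first by rewrite scale0r.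
apply/eqP; rewrite scaler_eq0 (negPf nz) /=.
suff /H/eqP : \sum_(q <- s2) (ev q.1 d * ev q.1 d) *: q.2 = 0.
  by rewrite scaler_eq0 mulf_eq0 (negPf nz).
rewrite -[RHS]dd s2E !(br_sumr lie); apply: eq_big_seq => q qs.
by rewrite ws2 // (brZr lie) ws2 // scalerA.
Qed.

Lemma hvec_wsp0 c : wsp 0 (hvec c).
Proof. by move=> d; rewrite hvec_comm ev0l scale0r. Qed.

Lemma root0 : root 0.
Proof.
case: toral => _ [[c nc] _]; exists (hvec c); split=> //; exact: hvec_wsp0.
Qed.

Lemma wsp_root be x : wsp be x -> x = 0 \/ root be.
Proof. by case: (eqVneq x 0) => [|nx]; [left | right; exists x]. Qed.

(** * Sl2-triples and root strings *)

Definition sl2_triple al x y := [/\ wsp al x, wsp (- al) y & br x y = hv al].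

Lemma root_x_sl2 al x : root_x al -> wsp al x -> x != 0 -> exists y, sl2_triple al x y.
Proof.
move=> Ral wx nx; have [_ /(_ al Ral x wx nx) [y [wy xy]]] := t3.
exists ((2 / fdot al al) *: y); split=> //; first exact: (eigenZ lie).
by rewrite (brZr lie) xy hvE.
Qed.

Lemma two_neq0 : (2 : F) != 0.
Proof. by rewrite (natF_eq0 char0). Qed.

Lemma hv_neq0 al : fdot al al != 0 -> hv al != 0.
Proof.
move=> nal; rewrite hvE scaler_eq0 mulf_eq0 invr_eq0 (negPf two_neq0) (negPf nal) /=.
by apply/negP => /eqP /tv_eq0 al0; rewrite al0 fdot0l eqxx in nal.
Qed.

Lemma sl2_triple_sym al x y : sl2_triple al x y -> sl2_triple (- al) y x.
Proof.
case=> wx wy xy; split=> //; first by rewrite opprK.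
rewrite (br_anti lie) xy !hvE fdotNl fdotNr opprK -scalerN; congr (_ *: _).
by rewrite tvN.
Qed.

Lemma sl2_triple_root al x y : fdot al al != 0 -> sl2_triple al x y -> root_x al.
Proof.
move=> nal [wx wy xy]; split=> //; exists x; split=> //; apply/negP => /eqP x0.
by move/negP: (hv_neq0 nal); rewrite -xy x0 (br0l lie).
Qed.

Lemma root_xN al : root_x al -> root_x (- al).
Proof.
move=> Ral; have [[x [nx wx]] nal] := Ral.
have [y /sl2_triple_sym xy] := root_x_sl2 Ral wx nx.
by apply: sl2_triple_root xy; rewrite fdotNl fdotNr opprK.
Qed.

(** Climbing [k] steps with [x] and descending [k + j] steps with [y] leads to weight [be - j al],
    and the vector is nonzero while [k + j <= p]. Since [z = p - 2 k], the condition [j <= z]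
    suffices. *)
Lemma sl2_triple_string al x y (M : L -> Prop) be v :
  fdot al al != 0 -> sl2_triple al x y ->
  (forall z, M z -> M (br x z)) -> (forall z, M z -> M (br y z)) ->
  M v -> v != 0 -> wsp be v ->
  exists z : int, 2 * fdot be al = z%:~R * fdot al al /\
    forall j : nat, (j%:Z <= z) -> exists w, [/\ M w, w != 0 & wsp (be - al *+ j) w].
Proof.
move=> nal xy Mx My Mv nv wv; have Ral := sl2_triple_root nal xy.
have Ral' := root_xN Ral; case: (xy) => wx wy exy.
have [||k [p [cE st]]] := sl2_string char0 lie (e := x) (f := y) (t := hv al) _ _ exy
   (fun z => t4 Ral wx z) (fun z => t4 Ral' wy z) Mx My Mv nv (wsp_hv al wv).
- by rewrite (wsp_hv al wx) mulfK.
- by rewrite (wsp_hv al wy) fdotNl mulrN mulNr mulfK // scaleNr.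
exists (p%:Z - (2 * k)%:Z); split.
  by rewrite intrB -[p%:~R]/(p%:R) -[(2 * k)%:~R]/((2 * k)%:R) -cE mulfVK.
move=> j jz; have [|Mw nw] := st (k + j)%N; first by lia.
exists (iter (k + j) (br y) (iter k (br x) v)); split=> //.
have := wsp_iter (k + j) wy (wsp_iter k wx wv).
by rewrite mulNrn mulrnDr opprD addrA addrK.
Qed.

(** The triple of [al] gives the descending half; the opposite triple, whose Cartan integer is
    [- z], gives the ascending half. *)
Lemma root_string al be : root_x al -> root be ->
  exists z : int, 2 * fdot be al = z%:~R * fdot al al /\
    (forall j : nat, j%:Z <= z -> root (be - al *+ j)) /\
    (forall j : nat, j%:Z <= - z -> root (be + al *+ j)).
Proof.
move=> Ral [v [nv wv]]; have [[x [nx wx]] nal] := Ral.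
have [y xy] := root_x_sl2 Ral wx nx; have yx := sl2_triple_sym xy.
have nal' : fdot (- al) (- al) != 0 by rewrite fdotNl fdotNr opprK.
have [//|//|z [zE zr]] := sl2_triple_string (M := fun _ => True) nal xy _ _ I nv wv.
have [//|//|z' [zE' zr']] := sl2_triple_string (M := fun _ => True) nal' yx _ _ I nv wv.
exists z; split=> //; split=> j jz; first by have [w [_ nw ww]] := zr j jz; exists w.
have zz' : z' = - z.
  apply: (intF_inj char0); apply: (mulIf nal).
  by move: zE'; rewrite !fdotNr fdotNl opprK => <-; rewrite mulrN zE intrN mulNr.
have [|w [_ nw ww]] := zr' j; first by rewrite zz'.
by exists w; split=> //; rewrite -mulNrn opprK in ww.
Qed.

Lemma root_reflect al be (z : int) : root_x al -> root be ->
  2 * fdot be al = z%:~R * fdot al al -> root (be - al *~ z).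
Proof.
move=> Ral Rbe zE; have [z' [zE' [lo hi]]] := root_string Ral Rbe.
have zz : z' = z.
  by apply: (intF_inj char0); case: Ral => _ nal; apply: (mulIf nal); rewrite -zE -zE'.
case: z zz {zE} => k zk; first by rewrite -pmulrn; apply: lo; rewrite zk.
by rewrite NegzE mulrNz opprK -pmulrn; apply: hi; rewrite zk NegzE opprK.
Qed.

(** * Isotropic roots *)

(** As [(de, de) = 0], [t_de] acts on the whole string by the nonzero scalar [(al, de)], so [x] and
    [y] satisfy a Weyl algebra relation there. Either no power of [y] kills [v], and the direction
    is [- de], or from the last nonzero vector [w] on the way down no power of [x] kills [w], and
    the direction is [de]. *)
Lemma iso_string de al : root_0 de -> root al -> fdot al de != 0 ->
  exists de', [/\ fdot de' de' = 0, fdot al de' != 0 & forall m, root (al + de' *+ m)].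
Proof.
move=> Rde [v [nv wv]] g0; have [_ de0] := Rde.
have [/(_ de Rde) [x [y [wx [wy xy]]]] _] := t3.
case: (classic (exists k, iter k (br y) v = 0)) => [nil|nnil]; last first.
  exists (- de); rewrite fdotNl !fdotNr opprK oppr_eq0; split=> // m.
  exists (iter m (br y) v); split; last exact: wsp_iter.
  by apply/negP => /eqP E; case: nnil; exists m.
have [k [yw kmin]] := nilp_last nv nil.
pose w := iter k (br y) v; have {}yw : br y w = 0 by [].
have nw : w != 0 by apply: kmin.
have ww m : wsp (al - de *+ k + de *+ m) (iter m (br x) w).
  by apply: wsp_iter => //; rewrite -mulNrn; apply: wsp_iter.
have low m : br y (iter m.+1 (br x) w) = (- (m.+1%:R * fdot al de)) *: iter m (br x) w.
  elim: m => [|m IH].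
    rewrite /= (br_jacobi lie) yw (br0r lie) addr0 (br_anti lie y) xy (brNl lie).
    rewrite (wsp_tv de (ww 0%N)) fdotDl fdotBl !fdotMnl de0 !mulr0 subr0 addr0.
    by rewrite mul1r scaleNr.
  rewrite iterS (br_jacobi lie) IH (br_anti lie y) xy (brNl lie) (wsp_tv de (ww m.+1)).
  rewrite fdotDl fdotBl !fdotMnl de0 !mulr0 subr0 addr0 (brZr lie) -iterS -scaleNr -scalerDl.
  by congr (_ *: _); rewrite -[m.+2]add1n natrD; ring.
exists de; split=> // m; exists (iter (m + k) (br x) w); split; last first.
  by move: (ww (m + k)%N); rewrite mulrnDr addrA addrAC subrK.
elim: (m + k)%N => // j IH; apply/negP => /eqP E; move: (low j).
rewrite E (br0r lie) => /esym/eqP; rewrite scaler_eq0 (negPf IH) orbF oppr_eq0.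
by rewrite mulf_eq0 (natF_eq0 char0) (negPf g0).
Qed.

Lemma iso_orth de al : root_0 de -> root_x al -> fdot de al = 0.
Proof.
(* The string of [iso_string] is infinite, but [al + 3 de'] already violates the
   integrality of [2 (al, al + 3 de') / (al + 3 de', al + 3 de')]. *)
move=> Rde Ral; have [Rr nal] := Ral; apply/eqP; rewrite fdotC; apply: contraT => g0.
have [de' [d0 {}g0 Rm]] := iso_string Rde Rr g0.
have [z1 [z1E _]] := root_string Ral (Rm 1%N).
(* [z1] is the Cartan integer of [al + de'] against [al], so [z] is that of [de']. *)
pose z := z1 - 2.
have zE : 2 * fdot al de' = z%:~R * fdot al al.
  by move: z1E; rewrite mulr1n fdotDl [fdot de' al]fdotC mulrDr /z intrB mulrBl => <-; ring.
have nz : z != 0.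
  apply/negP => /eqP z0; move: zE; rewrite z0 mul0r => /eqP.
  by rewrite mulf_eq0 (negPf two_neq0) (negPf g0).
have norm : fdot (al + de' *+ 3) (al + de' *+ 3) = (1 + 3 * z)%:~R * fdot al al.
  rewrite !(fdotDl, fdotDr, fdotMnl, fdotMnr) d0 [fdot de' al]fdotC.
  by have H := esym zE; ring: H.
have R3 : root_x (al + de' *+ 3).
  by split=> //; rewrite norm mulf_neq0 // (intF_eq0 char0); lia.
have [w [wE _]] := root_string R3 Rr.
(* Here [1 + 3 z] divides [2 + 3 z], hence divides 1. The coefficient 3 excludes both [1 + 3 z = 0]
   and [1 + 3 z = -1], which leaves [z = 0]. *)
suff wz : 2 + 3 * z = w * (1 + 3 * z).
  by have := @intdvd_le (w - 1) (1 + 3 * z) 1; rewrite mulrBl -wz mul1r; lia.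
apply: (intF_inj char0); apply: (mulIf nal).
rewrite [(w * _)%:~R]intrM -mulrA -norm -wE fdotDr fdotMnr.
by have H := esym zE; ring: H.
Qed.

(** For isotropic [be], T5b provides a nonisotropic [al] with [al + be] a root, again nonisotropic
    because [be] is orthogonal to [al]. Being orthogonal to [al] and to [al + be], [de] is
    orthogonal to [be]. *)
Lemma rad_root_0 de : root_0 de -> rad de.
Proof.
move=> Rde be Rbe; case: (eqVneq (fdot be be) 0) => [b0|nb]; last exact: iso_orth.
have [al [Ral Rab]] := t5b (conj Rbe b0).
have bal := iso_orth (conj Rbe b0) Ral.
have := iso_orth Rde (al := al + be); rewrite fdotDr (iso_orth Rde Ral) add0r; apply.
split=> //; rewrite !(fdotDl, fdotDr) [fdot al be]fdotC bal b0 !addr0.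
by case: Ral.
Qed.

(** * Cartan integers and norms of nonisotropic roots *)

(** If [t >= 5], then [be - 2 al] is a root of norm [5 - 2 t] times that of [al], and integrality
    makes [5 - 2 t] divide [t - 4], although [0 < t - 4 < 2 t - 5]. The value [t = 4] escapes since
    [t - 4] is then zero. *)
Lemma equal_norm_lt5 al be (t : int) : root_x al -> root_x be -> fdot be be = fdot al al ->
  2 * fdot be al = t%:~R * fdot al al -> t < 5.
Proof.
move=> Ral Rbe E tE; rewrite ltNge; apply/negP => t5.
have [_ nal] := Ral; have [Rb _] := Rbe.
have [z [zE [lo _]]] := root_string Ral Rb.
have zt : z = t by apply: (intF_inj char0); apply: (mulIf nal); rewrite -tE -zE.
have norm : fdot (be - al *+ 2) (be - al *+ 2) = (5 - 2 * t)%:~R * fdot al al.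
  rewrite !(fdotBl, fdotBr, fdotMnl, fdotMnr) E [fdot al be]fdotC.
  by have H := esym tE; ring: H.
have R2 : root_x (be - al *+ 2).
  split; first by apply: lo; lia.
  by rewrite norm mulf_neq0 // (intF_eq0 char0); lia.
have [w [wE _]] := root_string R2 (proj1 Ral).
suff tw : t - 4 = w * (5 - 2 * t) by have := intdvd_le tw; lia.
apply: (intF_inj char0); apply: (mulIf nal).
rewrite [(w * _)%:~R]intrM -mulrA -norm -wE fdotBr fdotMnr [fdot al be]fdotC.
by have H := esym tE; ring: H.
Qed.

Lemma equal_norm_le2 al be (t : int) : root_x al -> root_x be -> fdot be be = fdot al al ->
  2 * fdot be al = t%:~R * fdot al al -> `|t| <= 2.
Proof.
(* Reflecting [al] in [be] replaces [t] by [t ^ 2 - 2]. *)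
move=> Ral Rbe E tE.
have R' : root (al - be *~ t).
  by apply: root_reflect => //; [case: Ral | rewrite fdotC E].
have norm : fdot (al - be *~ t) (al - be *~ t) = fdot al al.
  rewrite !(fdotBl, fdotBr, fdotMl, fdotMr) E [fdot al be]fdotC.
  by have H := esym tE; ring: H.
have Rx' : root_x (- (al - be *~ t)).
  by apply: root_xN; split=> //; rewrite norm; case: Ral.
have := equal_norm_lt5 (t := t * t - 2) Ral Rx'.
rewrite fdotNl fdotNr opprK norm => /(_ erefl).
suff -> : 2 * fdot (- (al - be *~ t)) al = (t * t - 2)%:~R * fdot al al by move=> /(_ erefl); nia.
by rewrite fdotNl fdotBl fdotMl; have H := esym tE; ring: H.
Qed.

Lemma cart_bound al be (t u : int) : root_x al -> root_x be ->
  2 * fdot be al = t%:~R * fdot al al -> 2 * fdot be al = u%:~R * fdot be be ->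
  0 <= t * u <= 4.
Proof.
(* [al] and its reflection in [be] have equal norms and Cartan integer [2 - t u]. *)
move=> Ral Rbe tE uE.
have R' : root (al - be *~ u).
  by apply: root_reflect => //; [case: Ral | rewrite fdotC].
have norm : fdot (al - be *~ u) (al - be *~ u) = fdot al al.
  rewrite !(fdotBl, fdotBr, fdotMl, fdotMr) [fdot al be]fdotC.
  by have H := esym uE; ring: H.
have Rx' : root_x (al - be *~ u) by split=> //; rewrite norm; case: Ral.
have := equal_norm_le2 (t := 2 - t * u) Ral Rx' norm.
suff -> : 2 * fdot (al - be *~ u) al = (2 - t * u)%:~R * fdot al al by move=> /(_ erefl); nia.
by rewrite fdotBl fdotMl; have H := esym tE; ring: H.
Qed.

(** The roots whose norm is a positive rational multiple of that of [be] form a class. If [al] were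
    outside it, T5a would give nonorthogonal [ga] inside and [ga'] outside; their Cartan integers
    are nonzero with positive product, so the two norms do have a positive rational ratio. *)
Lemma norm_ratio al be : root_x al -> root_x be ->
  exists a b : nat, [/\ (0 < a)%N, (0 < b)%N & a%:R * fdot al al = b%:R * fdot be be].
Proof.
move=> Ral Rbe.
pose P ga := exists a b : nat, [/\ (0 < a)%N, (0 < b)%N & a%:R * fdot ga ga = b%:R * fdot be be].
apply: NNPP => nP.
have [||ga [ga' [Rga [[a [b [a0 b0 ab]]] [Rga' [nP' ng]]]]]] := t5a (P := P).
- by exists be; split=> //; exists 1%N, 1%N.
- by exists al.
have [t [tE _]] := root_string Rga (proj1 Rga').
have [u [uE _]] := root_string Rga' (proj1 Rga).
have bd := cart_bound Rga Rga' tE; rewrite fdotC in uE; have {}bd := bd u uE.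
have n2 : 2 * fdot ga' ga != 0 by rewrite mulf_neq0 ?two_neq0 // fdotC.
have nt : t != 0 by apply: contraNneq n2 => t0; rewrite tE t0 mul0r.
have nu : u != 0 by apply: contraNneq n2 => u0; rewrite uE u0 mul0r.
case: nP'; exists (`|u| * a)%N, (`|t| * b)%N; split; [lia | lia |].
(* [t] and [u] share the sign [sg], so it cancels from [t (ga, ga) = u (ga', ga')]. *)
have [sg [tE' uE']] : exists sg : int, t = sg * `|t|%N /\ u = sg * `|u|%N /\ sg * sg = 1.
  by case: (lerP 0 t) => t0; [exists 1 | exists (-1)]; split; nia.
rewrite !natrM -[_ * b%:R * _]mulrA -ab.
have E : t%:~R * fdot ga ga = u%:~R * fdot ga' ga' by rewrite -tE uE.
case: uE' => uE' sg1.
have nsg : (sg%:~R : F) != 0 by rewrite (intF_eq0 char0); nia.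
apply: (mulfI nsg); move: E; rewrite {1}tE' {1}uE' !intrM -!pmulrn -!mulrA => E.
transitivity (a%:R * (sg%:~R * (`|u|%N%:R * fdot ga' ga'))); first by ring.
by rewrite -E; ring.
Qed.

(** * The finite root system *)

Section Setup.
Variables (l : nat) (ad : 'I_l -> 'rV[F]_n) (e f : 'I_l -> L).
Hypothesis HS : standard_setup br B h ad e f.
Implicit Types (mu nu : 'rV[F]_n) (k : 'I_l -> int).

Notation qcomb := (qcomb ad).
Notation zcomb := (zcomb ad).
Notation in_Rdot := (in_Rdot br B h ad).
Notation in_Rred := (in_Rred br B h ad).
Notation in_Lambda := (in_Lambda br B h).

Lemma rad0 : rad 0. Proof. by move=> be _; rewrite fdot0l. Qed.
Lemma radB mu nu : rad mu -> rad nu -> rad (mu - nu).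
Proof. by move=> rm rn be Rb; rewrite fdotBl rm // rn // subr0. Qed.
Lemma radZ a mu : rad mu -> rad (a *: mu).
Proof. by move=> rm be Rb; rewrite fdotZl rm // mulr0. Qed.

Lemma Lambda_root_0 de : root_0 de -> in_Lambda de.
Proof. by move=> Rd P _ _ PR; apply: PR. Qed.
Lemma Lambda0 : in_Lambda 0. Proof. by move=> P. Qed.
Lemma LambdaB mu nu : in_Lambda mu -> in_Lambda nu -> in_Lambda (mu - nu).
Proof. by move=> Lm Ln P P0 PB PR; apply: (PB); [exact: Lm | exact: Ln]. Qed.
Lemma LambdaN mu : in_Lambda mu -> in_Lambda (- mu).
Proof. by move=> Lm; rewrite -sub0r; apply: LambdaB => //; apply: Lambda0. Qed.
Lemma LambdaD mu nu : in_Lambda mu -> in_Lambda nu -> in_Lambda (mu + nu).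
Proof. by move=> Lm Ln; rewrite -[nu]opprK; apply: LambdaB => //; apply: LambdaN. Qed.
Lemma rad_Lambda de : in_Lambda de -> rad de.
Proof. by apply; [exact: rad0 | exact: radB | exact: rad_root_0]. Qed.

Lemma ad_root i : root (ad i). Proof. by case: HS. Qed.

Lemma zcombB k k' : zcomb k - zcomb k' = zcomb (fun i => k i - k' i).
Proof. by rewrite -sumrB; apply: eq_bigr => i _; rewrite intrB scalerBl. Qed.
Lemma zcomb_delta i z : zcomb (fun j => if j == i then z else 0) = ad i *~ z.
Proof.
rewrite /Defs.zcomb (bigD1 i) //= eqxx big1 ?addr0 ?scaler_int // => j /negPf ->.
by rewrite scale0r.
Qed.
Lemma zcomb_delta1 i : zcomb (fun j => if j == i then 1 else 0) = ad i.
Proof. exact: zcomb_delta. Qed.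
Lemma eq_zcomb k k' : k =1 k' -> zcomb k = zcomb k'.
Proof. by move=> E; apply: eq_bigr => i _; rewrite E. Qed.
Lemma qcombB (c d : 'I_l -> rat) : qcomb c - qcomb d = qcomb (fun i => c i - d i).
Proof. by rewrite -sumrB; apply: eq_bigr => i _; rewrite (ratFB char0) scalerBl. Qed.
Lemma zcombE k : zcomb k = qcomb (fun i => (k i)%:~R).
Proof. by apply: eq_bigr => i _; rewrite (ratF_int char0). Qed.
Lemma qcomb_rad (c : 'I_l -> rat) : rad (qcomb c) -> forall i, c i = 0.
Proof. by case: HS => _ []; auto. Qed.
Lemma zcomb_rad k : rad (zcomb k) -> forall i, k i = 0.
Proof.
by rewrite zcombE => /qcomb_rad H i; move/eqP: (H i); rewrite intr_eq0 => /eqP.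
Qed.
Lemma zcomb_inj k k' : rad (zcomb k - zcomb k') -> k =1 k'.
Proof. by rewrite zcombB => /zcomb_rad H i; apply/eqP; rewrite -subr_eq0 H. Qed.

Lemma fdot_zcomb_r mu k : fdot mu (zcomb k) = \sum_(i < l) (k i)%:~R * fdot mu (ad i).
Proof. by rewrite fdotC fdot_suml; apply: eq_bigr => i _; rewrite fdotZl fdotC. Qed.
Lemma rad_zcomb mu k : rad mu -> fdot mu (zcomb k) = 0.
Proof. by move=> rm; rewrite fdot_zcomb_r big1 // => i _; rewrite rm ?mulr0 //; apply: ad_root. Qed.

Lemma Rdot_intro k al : root al -> rad (al - zcomb k) -> in_Rdot (zcomb k).
Proof. by move=> Ral ra; split; [exists (fun i => (k i)%:~R); apply: zcombE | exists al]. Qed.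

(** A root congruent to [mu] modulo the radical is also congruent to an integral combination of the
    base with coefficients of one sign. Independence of the base modulo the radical identifies it
    with the rational combination [mu]. *)
Lemma Rdot_zcomb mu : in_Rdot mu ->
  exists k, mu = zcomb k /\ ((forall i, 0 <= k i) \/ (forall i, k i <= 0)).
Proof.
case=> -[c ->] [al [Ral rc]]; case: HS => _ [_ [/(_ al Ral) [k [sg rk]] _]].
exists k; split=> //.
have /qcomb_rad H : rad (qcomb (fun i => c i - (k i)%:~R)).
  rewrite -qcombB -zcombE.
  have -> : qcomb c - zcomb k = al - zcomb k - (al - qcomb c).
    by rewrite opprB [RHS]addrC addrA subrK.
  exact: radB.
rewrite zcombE; apply: eq_bigr => i _; congr (ratr _ *: _).
by apply/eqP; rewrite -subr_eq0 H.
Qed.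

Lemma root_Rdot al : root al -> exists mu, in_Rdot mu /\ rad (al - mu).
Proof.
move=> Ral; case: HS => _ [_ [/(_ al Ral) [k [_ rk]] _]].
by exists (zcomb k); split=> //; apply: Rdot_intro rk.
Qed.

Lemma rad_Rdot nu mu : rad nu -> in_Rdot mu -> fdot nu mu = 0.
Proof. by move=> rx /Rdot_zcomb [k [-> _]]; apply: rad_zcomb. Qed.

Lemma Rdot_uniq mu nu : in_Rdot mu -> in_Rdot nu -> rad (mu - nu) -> mu = nu.
Proof.
move=> /Rdot_zcomb [k [-> _]] /Rdot_zcomb [k' [-> _]] /zcomb_inj.
exact: eq_zcomb.
Qed.

Lemma fdot_Rdot al mu nu : in_Rdot nu -> rad (al - mu) -> fdot al nu = fdot mu nu.
Proof.
by move=> Rnu ra; apply/eqP; rewrite -subr_eq0 -fdotBl rad_Rdot.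
Qed.
Lemma fdot_root al mu be : root be -> rad (al - mu) -> fdot al be = fdot mu be.
Proof. by move=> Rb ra; apply/eqP; rewrite -subr_eq0 -fdotBl ra. Qed.

Lemma fdot_Rdot2 al mu be nu : root al -> root be -> in_Rdot mu -> in_Rdot nu ->
  rad (al - mu) -> rad (be - nu) -> fdot al be = fdot mu nu.
Proof.
move=> Ra Rb Rm Rn ra rb; rewrite (fdot_root Rb ra) fdotC (fdot_Rdot Rm rb).
exact: fdotC.
Qed.

Lemma Rdot0 : in_Rdot 0.
Proof.
have -> : 0 = zcomb (fun _ => 0) by rewrite /Defs.zcomb big1 // => i _; rewrite scale0r.
apply: Rdot_intro root0 _; rewrite /Defs.zcomb big1 ?subr0; first exact: rad0.
by move=> i _; rewrite scale0r.
Qed.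

(** An isotropic [al] would lie in the radical, and then so would [mu], forcing [mu = 0]. *)
Lemma Rdot_neq0 al mu : root al -> in_Rdot mu -> rad (al - mu) -> mu != 0 -> root_x al.
Proof.
move=> Ra Rm ra m0; split=> //; apply/negP => /eqP a0; case/eqP: m0.
apply: Rdot_uniq => //; first exact: Rdot0.
by rewrite subr0 -[mu](subKr al); apply: radB => //; apply: rad_root_0.
Qed.
Lemma root_x_Rdot_neq0 al mu : root_x al -> rad (al - mu) -> mu != 0.
Proof.
move=> [Ra nal] ra; apply: contraNneq nal => m0; move: ra; rewrite m0 subr0 => ra.
by rewrite ra.
Qed.

Lemma ad_root_x i : root_x (ad i).
Proof.
split; first exact: ad_root.
apply/negP => /eqP a0; have := rad_root_0 (conj (ad_root i) a0).
by rewrite -(zcomb_delta1 i) => /zcomb_rad /(_ i); rewrite eqxx.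
Qed.
Lemma ad_norm i : fdot (ad i) (ad i) != 0. Proof. by case: (ad_root_x i). Qed.

Lemma root_in_Rdot al : root al -> (exists k, al = zcomb k) -> in_Rdot al.
Proof. by move=> Ra [k ak]; rewrite ak; apply: (Rdot_intro Ra); rewrite ak subrr; apply: rad0. Qed.
Lemma ad_Rdot i : in_Rdot (ad i).
Proof.
apply: root_in_Rdot (ad_root i) _; exists (fun j => if j == i then 1 else 0).
by rewrite zcomb_delta1.
Qed.

Lemma Rdot_cart mu nu : in_Rdot mu -> in_Rdot nu -> mu != 0 ->
  exists z : int, 2 * fdot nu mu = z%:~R * fdot mu mu /\ in_Rdot (nu - mu *~ z).
Proof.
move=> Rm Rn m0; have [_ [al [Ra ra]]] := Rm; have [_ [be [Rb rb]]] := Rn.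
have Rx := Rdot_neq0 Ra Rm ra m0; have [z [zE _]] := root_string Rx Rb.
exists z; rewrite -(fdot_Rdot2 Rb Ra Rn Rm rb ra) -(fdot_Rdot2 Ra Ra Rm Rm ra ra); split=> //.
have [k [mk _]] := Rdot_zcomb Rm; have [k' [nk _]] := Rdot_zcomb Rn.
have E : nu - mu *~ z = zcomb (fun i => k' i - z * k i).
  rewrite -zcombB -nk mk; congr (_ - _); rewrite -scaler_int scaler_sumr.
  by apply: eq_bigr => i _; rewrite scalerA intrM.
rewrite E; apply: (Rdot_intro (root_reflect Rx Rb zE)); rewrite -E.
have -> : be - al *~ z - (nu - mu *~ z) = be - nu - z%:~R *: (al - mu).
  rewrite scalerBr !scaler_int !opprD !opprK.
  by rewrite (AC (2*2) ((1*3)*(2*4))).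
by apply: radB => //; apply: radZ.
Qed.

Lemma RdotN mu : in_Rdot mu -> in_Rdot (- mu).
Proof.
move=> Rm; case: (eqVneq mu 0) => [->|m0]; first by rewrite oppr0; apply: Rdot0.
have [z [zE]] := Rdot_cart Rm Rm m0; suff -> : z = 2.
  by rewrite -[2]/(1 + 1) mulrzDr mulr1z opprD addrA subrr add0r.
have [_ [al [Ra ra]]] := Rm; have [_ nal] := Rdot_neq0 Ra Rm ra m0.
by rewrite (fdot_Rdot2 Ra Ra Rm Rm ra ra) in nal; apply/esym/(intF_inj char0)/(mulIf nal).
Qed.

(** By [cart_bound] these integers lie between -4 and 4. The shift by 4 stores them in ['I_9], so
    that the profiles form a finite type. *)
Lemma Rdot_cart_ad mu : in_Rdot mu ->
  exists g : {ffun 'I_l -> 'I_9}, forall i,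
    2 * fdot mu (ad i) = ((g i)%:Z - 4)%:~R * fdot (ad i) (ad i).
Proof.
move=> Rm.
have H i : exists g : 'I_9, 2 * fdot mu (ad i) = (g%:Z - 4)%:~R * fdot (ad i) (ad i).
  have [_ [al [Ra ra]]] := Rm.
  have [t [tE _]] := root_string (ad_root_x i) Ra.
  have t44 : -4 <= t <= 4.
    case: (eqVneq (fdot al al) 0) => [a0|na].
      have t0 : t = 0; last by rewrite t0.
      apply: (intF_inj char0); apply: (mulIf (ad_norm i)).
      by rewrite -tE (iso_orth (conj Ra a0) (ad_root_x i)) mulr0 mul0r.
    have [u [uE _]] := root_string (conj Ra na) (ad_root i).
    rewrite fdotC in uE; have bd := cart_bound (ad_root_x i) (conj Ra na) tE uE.
    case: (eqVneq t 0) => [->//|nt].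
    have nu : u != 0.
      apply: contraNneq nt => u0; rewrite -(intF_eq0 char0).
      by move: uE; rewrite u0 mul0r tE => /eqP; rewrite mulf_eq0 (negPf (ad_norm i)) orbF.
    by nia.
  have lt9 : (absz (t + 4)%R < 9)%N by lia.
  exists (Ordinal lt9); rewrite -(fdot_root (ad_root i) ra) tE; congr (_%:~R * _) => /=.
  lia.
have [g gP] := fin_all_exists H; exists [ffun i => g i] => i; rewrite ffunE; exact: gP.
Qed.

Lemma Rdot_finite : exists s : seq 'rV[F]_n, forall mu, in_Rdot mu <-> mu \in s.
Proof.
(* An element of [Rdot] is determined by its Cartan integers with the base. *)
pose prof mu (g : {ffun 'I_l -> 'I_9}) := forall i,
    2 * fdot mu (ad i) = ((g i)%:Z - 4)%:~R * fdot (ad i) (ad i).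
have H g : exists o, (forall mu, o = Some mu -> in_Rdot mu /\ prof mu g) /\
    (o = None -> forall mu, in_Rdot mu -> ~ prof mu g).
  case: (classic (exists mu, in_Rdot mu /\ prof mu g)) => [[mu mP]|nex].
    by exists (Some mu); split=> // nu [<-].
  by exists None; split=> // _ mu Rm pm; case: nex; exists mu.
have [o oP] := fin_all_exists H.
exists (pmap o (enum {ffun 'I_l -> 'I_9})) => mu; rewrite mem_pmap; split; last first.
  by move=> /mapP[g _ /esym og]; case: (oP g) => /(_ mu og) [].
move=> Rm; have [g gP] := Rdot_cart_ad Rm.
apply/mapP; exists g; first by rewrite mem_enum.
case E: (o g) => [nu|]; last by case: (oP g) => _ /(_ E mu Rm).
congr Some; have [Rn nP] := proj1 (oP g) _ E; apply: Rdot_uniq => //.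
have adP i : fdot (mu - nu) (ad i) = 0.
  by apply: (mulfI two_neq0); rewrite mulr0 fdotBl mulrBr gP nP subrr.
move=> be Rb; have [la [Rl rl]] := root_Rdot Rb; rewrite fdotC fdotBr.
rewrite (fdot_Rdot Rm rl) (fdot_Rdot Rn rl) -fdotBr fdotC.
have [k [-> _]] := Rdot_zcomb Rl.
by rewrite fdot_zcomb_r big1 // => i _; rewrite adP mulr0.
Qed.

Lemma ad_neq0 i : ad i != 0.
Proof. by apply: contraNneq (ad_norm i) => ->; rewrite fdot0l. Qed.

Lemma Rdot_reflect i mu (z : int) : in_Rdot mu ->
  2 * fdot mu (ad i) = z%:~R * fdot (ad i) (ad i) -> in_Rdot (mu - ad i *~ z).
Proof.
move=> Rm zE; have [z' [zE' Rm']] := Rdot_cart (ad_Rdot i) Rm (ad_neq0 i).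
suff -> : z = z' by [].
by apply: (intF_inj char0); apply: (mulIf (ad_norm i)); rewrite -zE.
Qed.

(** * Descent by simple reflections *)

(** Otherwise all Cartan integers with the base are nonpositive, and expanding [(al, al)] along
    [zcomb k] makes it a nonpositive multiple of itself. As [F] carries no order, [norm_ratio] turns
    this into an identity of integers. *)
Lemma pos_cart k al : root_x al -> rad (al - zcomb k) -> (forall i, 0 <= k i) ->
  exists i (c : int), 0 < c /\ 2 * fdot (zcomb k) (ad i) = c%:~R * fdot (ad i) (ad i).
Proof.
move=> Ral ra kpos; have [Ra nal] := Ral.
have Rk : in_Rdot (zcomb k) by apply: Rdot_intro ra.
pose cart i (c : int) := 2 * fdot (zcomb k) (ad i) = c%:~R * fdot (ad i) (ad i).
have /fin_all_exists[c cP] : forall i, exists c : int, cart i c.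
  by move=> j; have [z [zE _]] := Rdot_cart (ad_Rdot j) Rk (ad_neq0 j); exists z.
pose ratio i (ab : nat * nat) :=
  [/\ (0 < ab.1)%N, (0 < ab.2)%N & ab.1%:R * fdot (ad i) (ad i) = ab.2%:R * fdot al al].
have /fin_all_exists[ab abP] : forall i, exists ab, ratio i ab.
  by move=> j; have [a [b H]] := norm_ratio (ad_root_x j) Ral; exists (a, b).
apply: NNPP => nex.
have cneg i : c i <= 0.
  by rewrite leNgt; apply/negP => c0; case: nex; exists i, (c i); split; last exact: cP.
(* The norm of [ad i] is [(ab i).2 / (ab i).1] times that of [al]; [D] is a common denominator and
   [D' i] its cofactor. *)
pose D := (\prod_(i < l) (ab i).1)%N; pose D' i := (\prod_(j < l | j != i) (ab j).1)%N.
have DE i : D = ((ab i).1 * D' i)%N by rewrite /D (bigD1 i).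
have : 2 * D%:Z = \sum_(i < l) k i * c i * (D' i)%:Z * (ab i).2%:Z.
  apply: (intF_inj char0); apply: (mulIf nal).
  have NE : fdot al al = \sum_(i < l) (k i)%:~R * fdot (zcomb k) (ad i).
    by rewrite (fdot_Rdot2 Ra Ra Rk Rk ra ra) fdot_zcomb_r.
  rewrite {1}NE mulr_sumr raddf_sum mulr_suml /=; apply: eq_bigr => i _.
  have [_ _ abi] := abP i; have H := cP i; rewrite (DE i).
  transitivity ((k i)%:~R * (D' i)%:R * (ab i).1%:R * (2 * fdot (zcomb k) (ad i))).
    by rewrite PoszM; ring.
  rewrite H.
  transitivity ((k i)%:~R * (D' i)%:R * (c i)%:~R * ((ab i).1%:R * fdot (ad i) (ad i))).
    by ring.
  by rewrite abi; ring.
have D0 : 0 < D%:Z.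
  by rewrite ltz_nat prodn_gt0 // => i; case: (abP i).
have : \sum_(i < l) k i * c i * (D' i)%:Z * (ab i).2%:Z <= 0.
  by apply: sumr_le0 => i _; have := cneg i; have := kpos i; nia.
lia.
Qed.

(** Half of the reflected vector reflects back to half of [mu]; hence simple reflections preserve
    reducedness. *)
Lemma half_reflect i mu (c : int) : 2 * fdot mu (ad i) = c%:~R * fdot (ad i) (ad i) ->
  in_Rdot (2^-1 *: (mu - ad i *~ c)) -> in_Rdot (2^-1 *: mu).
Proof.
move=> cE Rh; have [z [zE Rz]] := Rdot_cart (ad_Rdot i) Rh (ad_neq0 i).
suff E : 2^-1 *: mu = 2^-1 *: (mu - ad i *~ c) - ad i *~ z by rewrite E.
have zc : z * 2 = - c.
  apply: (intF_inj char0); apply: (mulIf (ad_norm i)).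
  rewrite [(z * 2)%:~R]intrM mulrAC -zE fdotZl fdotBl fdotMl.
  rewrite mulrAC -mulrA mulVKf ?two_neq0 // mulrBr cE; ring.
rewrite scalerBr -addrA -opprD -[LHS]subr0; congr (_ - _); apply/esym.
apply: (scalerI two_neq0); rewrite scaler0 scalerDr scalerA divff ?two_neq0 // scale1r.
have zcF : 2 * z%:~R = - c%:~R :> F by rewrite mulrC -[2]/(2%:~R) -intrM zc intrN.
by rewrite -[ad i *~ z]scaler_int scalerA zcF scaleNr scaler_int subrr.
Qed.

Lemma reflect_back i mu (c : int) : 2 * fdot mu (ad i) = c%:~R * fdot (ad i) (ad i) ->
  2 * fdot (mu - ad i *~ c) (ad i) = (- c)%:~R * fdot (ad i) (ad i).
Proof. by move=> cE; rewrite fdotBl fdotMl mulrBr cE; ring. Qed.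

(** The Cartan integer of [ad i] against [z ad i] is [2 / z], so [z] is 1 or 2, and [z = 2]
    contradicts reducedness. *)
Lemma Rred_multiple i mu (z : int) : in_Rred mu -> mu = ad i *~ z -> 0 < z -> mu = ad i.
Proof.
move=> [Rm red] mE z0; have [_ [al [Ra ra]]] := Rm.
have m0 : mu != 0.
  by rewrite mE -scaler_int scaler_eq0 (intF_eq0 char0) (negPf (ad_neq0 i)) gt_eqF.
have [u [uE _]] := root_string (Rdot_neq0 Ra Rm ra m0) (ad_root i).
have uz : 2 = u * z.
  have zA : z%:~R * fdot (ad i) (ad i) != 0.
    by rewrite mulf_neq0 ?ad_norm // (intF_eq0 char0) gt_eqF.
  apply: (intF_inj char0); apply: (mulIf zA).
  move: uE; rewrite (fdot_Rdot2 Ra Ra Rm Rm ra ra) fdotC (fdot_root (ad_root i) ra) mE.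
  by rewrite !(fdotMl, fdotMr) => ->; ring.
case: (eqVneq z 1) => [z1|nz1]; first by rewrite mE z1.
have z2 : z = 2 by have := intdvd_le uz; lia.
case: red => [m00|[]]; first by rewrite m00 eqxx in m0.
by rewrite mE z2 -scaler_int scalerA mulVf ?two_neq0 // scale1r; apply: ad_Rdot.
Qed.

Lemma Rred_pos_ind (P : 'rV[F]_n -> Prop) :
  (forall i, P (ad i)) ->
  (forall i mu (z : int), 2 * fdot mu (ad i) = z%:~R * fdot (ad i) (ad i) ->
     P mu -> P (mu - ad i *~ z)) ->
  forall k, (forall i, 0 <= k i) -> in_Rred (zcomb k) -> zcomb k != 0 -> P (zcomb k).
Proof.
(* Descent on the height: a positive root that is not a multiple of a simple root
   stays positive under a simple reflection that lowers its height. *)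
move=> Pad Prefl k kpos.
have [N] : exists N : nat, \sum_(i < l) k i <= N%:Z by exists (absz (\sum_(i < l) k i)); lia.
elim: N k kpos => [|N IH] k kpos kN Rk m0.
  case/eqP: m0; rewrite /Defs.zcomb big1 // => i _.
  have -> : k i = 0; last by rewrite scale0r.
  by apply/eqP; rewrite (psumr_eq0P _ (_ : \sum_(i < l) k i = 0)) //;
    apply/eqP; rewrite eq_le kN sumr_ge0.
have [Rm red] := Rk; have [_ [al [Ra ra]]] := Rm.
have [i [c [c0 cE]]] := pos_cart (Rdot_neq0 Ra Rm ra m0) ra kpos.
case: (boolP [forall j, (j != i) ==> (k j == 0)]) => [/forallP allz|].
  have E : zcomb k = ad i *~ k i.
    rewrite -zcomb_delta; apply: eq_zcomb => j; case: eqVneq => [->//|ji].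
    by have := allz j; rewrite ji => /eqP.
  have ki : 0 < k i.
    rewrite lt_neqAle kpos andbT eq_sym; apply: contraNneq m0 => k0.
    by rewrite E k0 mulr0z.
  by rewrite (Rred_multiple Rk E ki).
rewrite negb_forall => /existsP[j]; rewrite negb_imply => /andP[ji kj].
pose k' i' := k i' - (if i' == i then c else 0).
have E : zcomb k - ad i *~ c = zcomb k' by rewrite -zcomb_delta zcombB.
have Rm' := Rdot_reflect Rm cE; have k'j : k' j = k j by rewrite /k' (negPf ji) subr0.
have kj0 : 0 < k j by rewrite lt_neqAle eq_sym kj kpos.
have m'0 : zcomb k' != 0.
  apply: contraNneq kj => z0; rewrite -k'j; apply/eqP.
  by apply: zcomb_rad; rewrite z0; apply: rad0.
(* The reflection does not change the positive coefficient at [j], and the coefficients of an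
   element of [Rdot] have one sign. *)
have k'pos i' : 0 <= k' i'.
  have [k'' [k''E sg]] := Rdot_zcomb Rm'.
  have kk : k' =1 k'' by apply: zcomb_inj; rewrite -E -k''E subrr; apply: rad0.
  by rewrite kk; case: sg => // sg; have := sg j; rewrite -kk k'j; lia.
have -> : zcomb k = zcomb k' - ad i *~ (- c) by rewrite -E mulrNz opprK subrK.
apply: Prefl; first by rewrite -E; apply: reflect_back.
apply: IH => //.
  rewrite sumrB.
  have -> : \sum_(i0 < l) (if i0 == i then c else 0) = c.
    by rewrite (bigD1 i) //= eqxx big1 ?addr0 // => i' /negPf ->.
  move: kN c0; move: (\sum_(i0 < l) k i0) => S; lia.
split; first by rewrite -E.
right; rewrite -E => /(half_reflect cE) Rh.
by case: red => [z|[]//]; rewrite z eqxx in m0.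
Qed.

Lemma in_RredN mu : in_Rred mu -> in_Rred (- mu).
Proof.
case=> Rm red; split; first exact: RdotN.
case: red => [->|nh]; [by left; rewrite oppr0 | right].
by rewrite scalerN => /RdotN; rewrite opprK.
Qed.

(** Negative elements follow from the positive case applied to [fun nu => P (- nu)], which has the
    same stability; [- ad i] is the reflection of [ad i] in itself. *)
Lemma Rred_ind (P : 'rV[F]_n -> Prop) :
  (forall i, P (ad i)) ->
  (forall i mu (z : int), 2 * fdot mu (ad i) = z%:~R * fdot (ad i) (ad i) ->
     P mu -> P (mu - ad i *~ z)) ->
  forall mu, in_Rred mu -> mu != 0 -> P mu.
Proof.
move=> Pad Prefl mu Rm m0; have [k [mE [kpos|kneg]]] := Rdot_zcomb (proj1 Rm).
  by move: Rm m0; rewrite mE; apply: Rred_pos_ind.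
have E : - mu = zcomb (fun i => - k i).
  rewrite mE -sumrN; apply: eq_bigr => i _; by rewrite intrN scaleNr.
rewrite -[mu]opprK E.
apply: (Rred_pos_ind (P := fun nu => P (- nu))) => // [i|i nu z zE Pn|i||].
- have -> : - ad i = ad i - ad i *~ 2 by rewrite mulrz_nat mulr2n opprD addrA subrr add0r.
  exact: Prefl.
- rewrite opprB addrC -[_ *~ _]opprK -mulrNz; apply: Prefl => //.
  by rewrite fdotNl mulrN zE intrN mulNr.
- by rewrite oppr_ge0.
- by rewrite -E; apply: in_RredN.
by rewrite -E oppr_eq0.
Qed.

Lemma Rred_root mu : in_Rred mu -> root mu.
Proof.
move=> Rm; case: (eqVneq mu 0) => [->|m0]; first exact: root0.
apply: (Rred_ind (P := root)) => // [i|i nu z zE Rn]; first exact: ad_root.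
exact: root_reflect (ad_root_x i) Rn zE.
Qed.

Lemma Rdot_half mu : in_Rdot mu -> mu != 0 ->
  in_Rred mu \/ exists nu, [/\ in_Rred nu, nu != 0 & mu = 2 *: nu].
Proof.
move=> Rm m0; case: (classic (in_Rdot (2^-1 *: mu))) => [Rn|]; last by left; split; auto.
right; exists (2^-1 *: mu).
have n0 : 2^-1 *: mu != 0 by rewrite scaler_eq0 invr_eq0 (negPf two_neq0).
split=> //; last by rewrite scalerA divff ?two_neq0 // scale1r.
split=> //; right => Rq.
(* [mu] and [mu / 4] would have Cartan integers [8] and [1/2]. *)
have [z [zE _]] := Rdot_cart Rm Rq m0; have [_ [al [Ra ra]]] := Rm.
have [_ nal] := Rdot_neq0 Ra Rm ra m0; rewrite (fdot_Rdot2 Ra Ra Rm Rm ra ra) in nal.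
have : z * 2 = 1.
  apply: (intF_inj char0); apply: (mulIf nal).
  rewrite [(z * 2)%:~R]intrM mulrAC -zE !fdotZl.
  by rewrite !mulrA mulrC !mulrA; field; rewrite two_neq0.
lia.
Qed.

(** The Cartan integer is [2 j], so [j] steps go only half way to the reflected root and stay inside
    the string. *)
Lemma root_shift al be (j : nat) : root_x be -> root al ->
  2 * fdot al be = (2 * j)%:R * fdot be be -> root (al - be *+ j).
Proof.
move=> Rb Ra E; have [z [zE [lo _]]] := root_string Rb Ra; apply: lo.
suff -> : z = (2 * j)%:Z by lia.
by apply: (intF_inj char0); apply: (mulIf (proj2 Rb)); rewrite -zE -pmulrn.
Qed.

(** The difference [al - mu] is a root: if [mu] is reduced it is itself a root, with Cartan integer
    2, and one step down the string suffices; if [mu = 2 nu] with [nu] reduced, the integer is 4 and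
    two steps along [nu] suffice. It is isotropic because it lies in the radical. *)
Lemma root_Rdot_iso al : root al ->
  exists mu de, [/\ in_Rdot mu, root_0 de & al = mu + de].
Proof.
move=> Ra; have [mu [Rm ra]] := root_Rdot Ra; exists mu, (al - mu).
split=> //; last by rewrite addrC subrK.
suff Rr : root (al - mu) by split=> //; rewrite fdotBr (rad_Rdot ra Rm) subr0 ra.
case: (eqVneq mu 0) => [->|m0]; first by rewrite subr0.
have Rx := Rdot_neq0 Ra Rm ra m0.
case: (Rdot_half Rm m0) => [/Rred_root Rmr|[nu [Rn n0 mE]]].
  rewrite -[mu]mulr1n; apply: root_shift => //.
    by split=> //; rewrite -(fdot_Rdot2 Ra Ra Rm Rm ra ra); case: Rx.
  by rewrite (fdot_root Rmr ra) muln1.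
have Rnr := Rred_root Rn.
rewrite mE scaler_nat; apply: root_shift => //.
  split=> //; case: Rx => _; rewrite (fdot_Rdot2 Ra Ra Rm Rm ra ra) mE fdotZl fdotZr.
  by apply: contraNneq => ->; rewrite !mulr0.
by rewrite (fdot_root Rnr ra) mE fdotZl mulrA -natrM.
Qed.

Lemma root_Rdot_Lambda al : root al ->
  exists mu s, [/\ in_Rdot mu, in_Lambda s & al = mu + s].
Proof.
move=> /root_Rdot_iso [mu [de [Rm Rd ->]]]; exists mu, de; split=> //.
exact: Lambda_root_0.
Qed.

(** * The split simple subalgebra *)

(** A reflection realized by a nonzero vector within the stable predicate [M]; a negative [z] calls
    for the opposite triple. *)
Lemma sl2_triple_reflect al x y (M : L -> Prop) be v (z : int) :
  fdot al al != 0 -> sl2_triple al x y ->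
  (forall z, M z -> M (br x z)) -> (forall z, M z -> M (br y z)) ->
  M v -> v != 0 -> wsp be v -> 2 * fdot be al = z%:~R * fdot al al ->
  exists w, [/\ M w, w != 0 & wsp (be - al *~ z) w].
Proof.
move=> nal xy Mx My Mv nv wv zE; case: z zE => j zE.
  have [z' [zE' st]] := sl2_triple_string nal xy Mx My Mv nv wv.
  rewrite -pmulrn; apply: st; suff -> : z' = j by [].
  by apply: (intF_inj char0); apply: (mulIf nal); rewrite -zE -zE'.
have nal' : fdot (- al) (- al) != 0 by rewrite fdotNl fdotNr opprK.
have [z' [zE' st]] := sl2_triple_string nal' (sl2_triple_sym xy) My Mx Mv nv wv.
rewrite NegzE mulrNz -mulNrz -pmulrn; apply: st; suff -> : z' = j.+1 by [].
apply: (intF_inj char0); apply: (mulIf nal).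
by move: zE'; rewrite !fdotNr fdotNl opprK => <-; rewrite mulrN zE NegzE intrN mulNr opprK.
Qed.

Notation Hdot_of := (Hdot_of B h ad).
Notation in_Hdot := (in_Hdot B h ad).
Notation gdot := (gdot br e f).
Notation wspD := (wspD br B h ad).
Notation restr := (restr B h ad).

Lemma ef_triple i : sl2_triple (ad i) (e i) (f i).
Proof. by case: HS => _ [_ [_ /(_ i) [we [wf [_ [_ ef]]]]]]. Qed.
Lemma wsp_e i : wsp (ad i) (e i). Proof. by case: (ef_triple i). Qed.
Lemma wsp_f i : wsp (- ad i) (f i). Proof. by case: (ef_triple i). Qed.
Lemma e_neq0 i : e i != 0.
Proof.
apply/negP => /eqP e0; have [_ _] := ef_triple i; rewrite e0 (br0l lie) => /esym/eqP.
by rewrite (negPf (hv_neq0 (ad_norm i))).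
Qed.

(** For distinct indices, [ad i - ad j] has coefficients of both signs in the base, so it is no root
    and the bracket vanishes. *)
Lemma br_ef i j : br (e i) (f j) = (if i == j then 2 / fdot (ad i) (ad i) else 0) *: tv (ad i).
Proof.
case: eqVneq => [<-|ij]; first by case: (ef_triple i) => _ _ ->; rewrite hvE.
rewrite scale0r; have [//|Rr] := wsp_root (eigen_br lie (wsp_e i) (wsp_f j)).
have [_ [_ [/(_ _ Rr) [k [sg rk]] _]]] := HS; move: rk.
rewrite -{1}(zcomb_delta1 i) -{1}(zcomb_delta1 j) zcombB => /zcomb_inj kE.
have := kE i; have := kE j; rewrite !eqxx (negPf ij) eq_sym (negPf ij) => kj ki.
by case: sg => sg; [have := sg j; rewrite -kj | have := sg i; rewrite -ki].
Qed.

Lemma Hdot_hvec (a : 'rV[F]_l) : exists c, Hdot_of a = hvec c.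
Proof.
exists (\sum_(i < l) a 0 i *: tc (ad i)); rewrite /Defs.Hdot_of /tv.
elim/big_rec2: _ => [|i y c _ ->]; last by rewrite hvecL.
by rewrite -(scale0r (hvec 0)) -hvecZ scale0r.
Qed.

Lemma Hdot_ofL a (c d : 'rV[F]_l) : Hdot_of (a *: c + d) = a *: Hdot_of c + Hdot_of d.
Proof.
rewrite scaler_sumr -big_split; apply: eq_bigr => i _.
by rewrite !mxE scalerDl scalerA.
Qed.
Lemma in_HdotL a x y : in_Hdot x -> in_Hdot y -> in_Hdot (a *: x + y).
Proof. by case=> c -> [d ->]; exists (a *: c + d); rewrite Hdot_ofL. Qed.
Lemma in_Hdot0 : in_Hdot 0.
Proof. by exists 0; rewrite /Defs.Hdot_of big1 // => i _; rewrite mxE scale0r. Qed.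
Lemma in_Hdot_tv i a : in_Hdot (a *: tv (ad i)).
Proof.
exists (a *: delta_mx 0 i); rewrite /Defs.Hdot_of (bigD1 i) //= big1 => [|j /negPf ji].
  by rewrite !mxE !eqxx mulr1 addr0.
by rewrite !mxE ji andbF mulr0 scale0r.
Qed.
Lemma Hdot_comm x y : in_Hdot x -> in_Hdot y -> br x y = 0.
Proof.
by case=> a -> [b ->]; have [c ->] := Hdot_hvec a; have [d ->] := Hdot_hvec b; apply: hvec_comm.
Qed.
Lemma Hdot_scalar al x y : in_Hdot x -> wsp al y -> exists a, br x y = a *: y.
Proof. by case=> b ->; have [c ->] := Hdot_hvec b; move=> wy; exists (ev al c); apply: wy. Qed.
Lemma Hdot_wsp0 x : in_Hdot x -> wsp 0 x.
Proof. by case=> b ->; have [c ->] := Hdot_hvec b; apply: hvec_wsp0. Qed.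

(* The innermost letter is [i]: [word g i [:: j1; ..; jr]] is [g j1, [g j2, .. [g jr, g i]]]. *)
Definition word (g : 'I_l -> L) i (w : seq 'I_l) : L := foldr (fun j x => br (g j) x) (g i) w.

Lemma word_wsp (g : 'I_l -> L) (b : 'I_l -> 'rV[F]_n) i w :
  (forall i, wsp (b i) (g i)) -> wsp (\sum_(j <- i :: w) b j) (word g i w).
Proof.
move=> wg; elim: w => [|j w IH]; first by rewrite big_seq1.
have -> : \sum_(j0 <- [:: i, j & w]) b j0 = b j + \sum_(j0 <- i :: w) b j0.
  by rewrite !big_cons addrCA.
exact: (eigen_br lie (wg j) IH).
Qed.

(** The positive, negative and toral parts of the triangular decomposition. Scalars are included so
    that [addspanZ] applies. *)
Definition gdot_gen (y : L) : Prop :=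
  (exists a i w, y = a *: word e i w) \/ (exists a i w, y = a *: word f i w) \/ in_Hdot y.

Lemma gdot_genZ b y : gdot_gen y -> gdot_gen (b *: y).
Proof.
case=> [[a [i [w ->]]]|[[a [i [w ->]]]|Hy]].
- by left; exists (b * a), i, w; rewrite scalerA.
- by right; left; exists (b * a), i, w; rewrite scalerA.
by right; right; rewrite -[_ *: _]addr0; apply: in_HdotL => //; apply: in_Hdot0.
Qed.

(** An opposite generator is moved through the word by the Jacobi identity: each commutator lies in
    [Hdot] and acts by a scalar on the shorter word. *)
Lemma word_lower (g g' : 'I_l -> L) (b : 'I_l -> 'rV[F]_n) (S : L -> Prop) i w j :
  (forall i, wsp (b i) (g i)) ->
  (forall i j, in_Hdot (br (g' j) (g i))) ->
  (forall y, in_Hdot y -> S y) -> (forall a i w, S (a *: word g i w)) ->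
  addspan S (br (g' j) (word g i w)).
Proof.
move=> wg gH HS' WS.
(* The induction needs this smaller set, since [ad (g m)] maps it into multiples of words in [g]. *)
pose S' y := in_Hdot y \/ exists a i w, y = a *: word g i w.
suff : addspan S' (br (g' j) (word g i w)).
  by apply: addspan_sub => y; case=> [Hy|[a [i' [w' ->]]]]; apply: addspan_in; auto.
elim: w => [|m w IH] /=; first by apply: addspan_in; left; apply: gH.
rewrite (br_jacobi lie); apply: addspanD.
  have [a ->] := Hdot_scalar (gH m j) (word_wsp i w wg).
  by apply: addspan_in; right; exists a, i, w.
elim: IH => [|y z Sy _ IHz]; first by rewrite (br0r lie); constructor.
rewrite (brDr lie); constructor=> //; right; case: Sy => [Hy|[a [i' [w' ->]]]].
  have [a E] := Hdot_scalar Hy (wg m); exists (- a), m, [::].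
  by rewrite (br_anti lie) E scaleNr.
by exists a, i', (m :: w'); rewrite (brZr lie).
Qed.

Lemma br_fe i j : in_Hdot (br (f j) (e i)).
Proof.
rewrite (br_anti lie) br_ef -scaleNr; exact: in_Hdot_tv.
Qed.
Lemma br_ef_Hdot i j : in_Hdot (br (e j) (f i)).
Proof. by rewrite br_ef; apply: in_Hdot_tv. Qed.

Lemma gdot_span x : gdot x -> addspan gdot_gen x.
Proof.
apply: (gen_subalg_sub lie) => [|a y z Sy Sz|y [i [->|->]]|y z [i gi]].
- by constructor.
- by apply: addspanD Sz; apply: addspanZ Sy; apply: gdot_genZ.
- by apply: addspan_in; left; exists 1, i, [::]; rewrite scale1r.
- by apply: addspan_in; right; left; exists 1, i, [::]; rewrite scale1r.
elim=> [|{}z z' gz _ IH]; first by rewrite (br0r lie); constructor.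
rewrite (brDr lie); apply: addspanD => //.
have He a j w : gdot_gen (a *: word e j w) by left; exists a, j, w.
have Hf a j w : gdot_gen (a *: word f j w) by right; left; exists a, j, w.
have HH u : in_Hdot u -> gdot_gen u by right; right.
case: gi gz => -> [[a [j [w ->]]]|[[a [j [w ->]]]|Hz]].
- by rewrite (brZr lie); apply: addspan_in; apply: (He a j (i :: w)).
- rewrite (brZr lie); apply: addspanZ; first exact: gdot_genZ.
  exact: (word_lower _ _ _ wsp_f br_ef_Hdot HH Hf).
- have [a E] := Hdot_scalar Hz (wsp_e i); rewrite (br_anti lie) E -scaleNr.
  by apply: addspan_in; apply: (He _ i [::]).
- rewrite (brZr lie); apply: addspanZ; first exact: gdot_genZ.
  exact: (word_lower _ _ _ wsp_e br_fe HH He).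
- by rewrite (brZr lie); apply: addspan_in; apply: (Hf a j (i :: w)).
have [a E] := Hdot_scalar Hz (wsp_f i); rewrite (br_anti lie) E -scaleNr.
by apply: addspan_in; apply: (Hf _ i [::]).
Qed.

Let sgd : subalg br gdot := subalg_gen _ _.

Lemma gdot_e i : gdot (e i). Proof. by apply: gen_subalg_in; exists i; left. Qed.
Lemma gdot_f i : gdot (f i). Proof. by apply: gen_subalg_in; exists i; right. Qed.
Lemma gdot_tv i : gdot (tv (ad i)).
Proof.
have -> : tv (ad i) = (fdot (ad i) (ad i) / 2) *: br (e i) (f i).
  rewrite br_ef eqxx scalerA mulrA divfK ?two_neq0 // divff ?ad_norm //.
  by rewrite scale1r.
by apply: (subalgZ sgd); apply: (subalg_br sgd); [apply: gdot_e | apply: gdot_f].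
Qed.
Lemma Hdot_gdot x : in_Hdot x -> gdot x.
Proof. by case=> a ->; apply: (subalg_sum sgd) => i _ _; apply: (subalgZ sgd); apply: gdot_tv. Qed.
Lemma word_gdot g i w : (forall i, gdot (g i)) -> gdot (word g i w).
Proof. by move=> Gg; elim: w => //= j w IH; apply: (subalg_br sgd). Qed.
Lemma gdot_gen_gdot y : gdot_gen y -> gdot y.
Proof.
case=> [[a [i [w ->]]]|[[a [i [w ->]]]|]]; last exact: Hdot_gdot.
  by apply: (subalgZ sgd); apply: word_gdot gdot_e.
by apply: (subalgZ sgd); apply: word_gdot gdot_f.
Qed.

Definition mult (s : seq 'I_l) (j : 'I_l) : int := (count_mem j s)%:Z.

Lemma sum_ad s : \sum_(j <- s) ad j = zcomb (mult s).
Proof.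
elim: s => [|i s IH]; first by rewrite big_nil /Defs.zcomb big1 // => j _; rewrite scale0r.
rewrite big_cons IH -{1}(zcomb_delta1 i) -big_split; apply: eq_bigr => j _ /=.
by rewrite -scalerDl -intrD /mult /= PoszD eq_sym; case: eqP.
Qed.
Lemma sum_adN s : \sum_(j <- s) - ad j = zcomb (fun j => - mult s j).
Proof. by rewrite sumrN sum_ad -sumrN; apply: eq_bigr => i _; rewrite intrN scaleNr. Qed.
Lemma sum_mult s : \sum_(j < l) mult s j = (size s)%:Z.
Proof.
elim: s => [|i s IH]; first by rewrite big1.
rewrite /= -add1n PoszD -IH (eq_bigr (fun j => (i == j)%:Z + mult s j)) => [|j _].
  by rewrite big_split /= (bigD1 i) //= eqxx big1 // => j /negPf; rewrite eq_sym => ->.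
by rewrite /mult /= PoszD.
Qed.

Lemma zcomb0 : zcomb (fun _ => 0) = 0.
Proof. by rewrite /Defs.zcomb big1 // => i _; rewrite scale0r. Qed.

Lemma zcomb_eq k k' : zcomb k = zcomb k' -> k =1 k'.
Proof. by move=> E; apply: zcomb_inj; rewrite E subrr; apply: rad0. Qed.

Lemma gdot_gen_wsp y : gdot_gen y -> exists k, wsp (zcomb k) y.
Proof.
case=> [[a [i [w ->]]]|[[a [i [w ->]]]|Hy]].
- by exists (mult (i :: w)); rewrite -sum_ad; apply: (eigenZ lie); apply: word_wsp wsp_e.
- exists (fun j => - mult (i :: w) j); rewrite -sum_adN; apply: (eigenZ lie).
  exact: word_wsp wsp_f.
by exists (fun _ => 0); rewrite zcomb0; apply: Hdot_wsp0.
Qed.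

Lemma gdot_gen_weight y k : gdot_gen y -> y != 0 -> wsp (zcomb k) y ->
  [\/ exists a i w, y = a *: word e i w /\ k =1 mult (i :: w),
      exists a i w, y = a *: word f i w /\ k =1 (fun j => - mult (i :: w) j) |
      in_Hdot y /\ k =1 (fun _ => 0)].
Proof.
move=> gy ny wy; case: (gy) => [[a [i [w yE]]]|[[a [i [w yE]]]|Hy]].
- apply: Or31; exists a, i, w; split=> //; apply: zcomb_eq.
  apply: (eigen_uniq ny wy); rewrite -sum_ad yE; apply: (eigenZ lie); exact: word_wsp wsp_e.
- apply: Or32; exists a, i, w; split=> //; apply: zcomb_eq.
  apply: (eigen_uniq ny wy); rewrite -sum_adN yE; apply: (eigenZ lie); exact: word_wsp wsp_f.
apply: Or33; split=> //; apply: zcomb_eq; apply: (eigen_uniq ny wy).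
by rewrite zcomb0; apply: Hdot_wsp0.
Qed.

Lemma gdot_weight_span x al : gdot x -> wsp al x ->
  addspan (fun y => gdot_gen y /\ wsp al y) x.
Proof.
move=> /gdot_span Sx wx; apply: (eigen_addspan lie) => // y /gdot_gen_wsp [k wk].
by exists (zcomb k).
Qed.

(** Reduces a claim about a weight space to words whose letters are counted by the weight. *)
Lemma gdot_weight_ind (Q : L -> Prop) x k : gdot x -> wsp (zcomb k) x ->
  Q 0 -> (forall y z, Q y -> Q z -> Q (y + z)) ->
  (forall a i w, k =1 mult (i :: w) -> Q (a *: word e i w)) ->
  (forall a i w, k =1 (fun j => - mult (i :: w) j) -> Q (a *: word f i w)) ->
  (forall y, k =1 (fun _ => 0) -> in_Hdot y -> Q y) -> Q x.
Proof.
move=> gx wx Q0 QD Qe Qf QH; have := gdot_weight_span gx wx.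
elim=> [//|y z [gy wy] _]; apply: QD.
case: (eqVneq y 0) => [->//|ny].
by case: (gdot_gen_weight gy ny wy) => [[a [i [w [-> kE]]]]|[a [i [w [-> kE]]]]|[Hy kE]]; auto.
Qed.

(** The weight has height one, so the only contributing word is the single letter [e i]. *)
Lemma gdot_ad x i : gdot x -> wsp (ad i) x -> exists a, x = a *: e i.
Proof.
rewrite -(zcomb_delta1 i) => gx wx.
apply: (gdot_weight_ind (Q := fun x => exists a, x = a *: e i) gx wx).
- by exists 0; rewrite scale0r.
- by move=> _ _ [a ->] [b ->]; exists (a + b); rewrite scalerDl.
- move=> a j w E; have wsz : size w = 0%N.
    have := sum_mult (j :: w); rewrite -(eq_bigr _ (fun j _ => E j)).
    by rewrite (bigD1 i) //= eqxx big1 => [|i' /negPf -> //]; rewrite addr0 => -[].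
  have ji : j = i by have := E j; rewrite /mult /= eqxx; case: eqP.
  by exists a; rewrite (size0nil wsz) ji.
- by move=> a j w /(_ i); rewrite eqxx /mult; lia.
by move=> y /(_ i); rewrite eqxx.
Qed.

Lemma gdot_2ad x i : gdot x -> wsp (2 *: ad i) x -> x = 0.
Proof.
have -> : 2 *: ad i = zcomb (fun j => if j == i then 2 else 0).
  by rewrite zcomb_delta -scaler_int.
move=> gx wx; apply: (gdot_weight_ind (Q := fun x => x = 0) gx wx) => //.
- by move=> _ _ -> ->; rewrite addr0.
(* By height only two letters are possible, both equal to [i], and [[e i, e i] = 0]. *)
- move=> a j [|j' [|j'' w]] E.
  + by have := E i; rewrite eqxx /mult /=; case: eqP.
  + have ji : j = i.
      by have := E j; rewrite /mult /=; case: (eqVneq j i) => // _; rewrite eqxx.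
    have ji' : j' = i.
      by have := E j'; rewrite /mult /=; case: (eqVneq j' i) => // _; rewrite eqxx addnC.
    by rewrite ji ji' /= (brxx lie) scaler0.
  have := sum_mult [:: j, j', j'' & w]; rewrite -(eq_bigr _ (fun j _ => E j)).
  by rewrite (bigD1 i) //= eqxx big1 => [|i' /negPf -> //]; rewrite addr0 => -[].
- by move=> a j w /(_ i); rewrite eqxx /mult; lia.
by move=> y /(_ i); rewrite eqxx.
Qed.

Lemma gdot_0 x : gdot x -> wsp 0 x -> in_Hdot x.
Proof.
rewrite -zcomb0 => gx wx; apply: (gdot_weight_ind (Q := in_Hdot) gx wx) => //.
- exact: in_Hdot0.
- by move=> y z Hy Hz; rewrite -[y]scale1r; apply: in_HdotL.
- by move=> a j w /(_ j); rewrite /mult /= eqxx.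
by move=> a j w /(_ j); rewrite /mult /= eqxx.
Qed.

Lemma gdot_reflect (M : L -> Prop) i be v (z : int) :
  (forall x y, gdot x -> M y -> M (br x y)) ->
  M v -> v != 0 -> wsp be v -> 2 * fdot be (ad i) = z%:~R * fdot (ad i) (ad i) ->
  exists w, [/\ M w, w != 0 & wsp (be - ad i *~ z) w].
Proof.
move=> Mbr; apply: (sl2_triple_reflect (ad_norm i) (ef_triple i)) => y.
  exact: Mbr (gdot_e i).
exact: Mbr (gdot_f i).
Qed.

(** For simple [nu] this is [gdot_2ad]; reflections transport it to every reduced [nu]. *)
Lemma gdot_double nu x : in_Rred nu -> nu != 0 -> gdot x -> wsp (2 *: nu) x -> x = 0.
Proof.
move=> Rn n0 gx wx; move: x gx wx.
apply: (Rred_ind (P := fun nu => forall x, gdot x -> wsp (2 *: nu) x -> x = 0)) => //.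
  by move=> i x; apply: gdot_2ad.
move=> i {n0 Rn}nu z zE IH x gx wx; apply: NNPP => /eqP nx.
(* The Cartan integer of the doubled reflected vector is [- 2 z], and reflecting it back gives
   weight [2 nu]. *)
have [||w [gw nw ww]] := gdot_reflect (M := gdot) (i := i) (z := - z *+ 2) _ gx nx wx.
- exact: (subalg_br sgd).
- by rewrite fdotZl mulrCA (reflect_back zE); ring.
case/eqP: nw; apply: IH => //; move: ww.
suff -> : 2 *: (nu - ad i *~ z) - ad i *~ (- z *+ 2) = 2 *: nu by [].
rewrite scalerBr -!scaler_int scalerA mulNrn intrN scaleNr opprK.
by rewrite -[z *+ 2]mulr_natl intrM subrK.
Qed.

Lemma gdot_weight_Rred x k : gdot x -> x != 0 -> wsp (zcomb k) x -> in_Rred (zcomb k).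
Proof.
move=> gx nx wx.
have Rk : in_Rdot (zcomb k).
  apply: root_in_Rdot; [by exists x | by exists k].
case: (eqVneq (zcomb k) 0) => [z0|n0]; first by split=> //; left.
case: (Rdot_half Rk n0) => // -[nu [Rn nn0 E]].
by case/eqP: nx; apply: (gdot_double Rn nn0 gx); rewrite -E.
Qed.

Lemma Rred_weight mu : in_Rred mu -> mu != 0 -> exists x, [/\ gdot x, x != 0 & wsp mu x].
Proof.
move=> Rm m0; apply: (Rred_ind (P := fun mu => exists x, [/\ gdot x, x != 0 & wsp mu x])) => //.
  by move=> i; exists (e i); split; [apply: gdot_e | apply: e_neq0 | apply: wsp_e].
move=> i nu z zE [x [gx nx wx]]; apply: (gdot_reflect (M := gdot) _ gx nx wx zE).
exact: (subalg_br sgd).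
Qed.

(** * Restriction of weights to [Hdot] *)

Lemma wspDE (nu : 'rV[F]_l) x : wspD nu x <-> eigenvec br Hdot_of nu x.
Proof. by split=> H a; rewrite H [ev _ _]evC. Qed.

Lemma restrE mu i : restr mu 0 i = fdot mu (ad i).
Proof. by rewrite mxE fdotE. Qed.
Lemma restr0 : restr 0 = 0.
Proof. by apply/rowP => i; rewrite restrE fdot0l mxE. Qed.
Lemma restrD mu nu : restr (mu + nu) = restr mu + restr nu.
Proof. by apply/rowP => i; rewrite !mxE evDl. Qed.
Lemma restrN mu : restr (- mu) = - restr mu.
Proof. by apply/eqP; rewrite -addr_eq0 -restrD addNr restr0. Qed.
Lemma restr_rad mu : rad mu -> restr mu = 0.
Proof. by move=> rm; apply/rowP => i; rewrite restrE rm ?mxE //; apply: ad_root. Qed.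

Lemma wsp_wspD al x : wsp al x -> wspD (restr al) x.
Proof.
move=> wx a; rewrite (br_suml lie) scaler_suml; apply: eq_bigr => i _.
by rewrite (brZl lie) (wsp_tv (ad i) wx) scalerA restrE.
Qed.

Lemma zcomb_orth k : (forall i, fdot (zcomb k) (ad i) = 0) -> forall i, k i = 0.
Proof.
move=> H; apply: zcomb_rad => be Rb; have [mu [Rm rb]] := root_Rdot Rb.
rewrite fdotC -[be](subrK mu) fdotDl rad_zcomb // add0r fdotC.
have [k' [-> _]] := Rdot_zcomb Rm.
by rewrite fdot_zcomb_r big1 // => i _; rewrite H mulr0.
Qed.
Lemma restr_zcomb_inj k k' : restr (zcomb k) = restr (zcomb k') -> k =1 k'.
Proof.
move=> E i; apply/eqP; rewrite -subr_eq0; apply/eqP.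
apply: (zcomb_orth (k := fun i => k i - k' i)) => j.
by rewrite -zcombB fdotBl -!restrE E subrr.
Qed.
Lemma restr_Rdot_inj mu nu : in_Rdot mu -> in_Rdot nu -> restr mu = restr nu -> mu = nu.
Proof.
by move=> /Rdot_zcomb [k [-> _]] /Rdot_zcomb [k' [-> _]] /restr_zcomb_inj; apply: eq_zcomb.
Qed.

(** The generators of [gdot] have integral weights, on which restriction to [Hdot] is injective; so
    a weight vector for [Hdot] is one for the whole torus. *)
Lemma gdot_wspD (nu : 'rV[F]_l) x : gdot x -> x != 0 -> wspD nu x ->
  exists k, nu = restr (zcomb k) /\ wsp (zcomb k) x.
Proof.
move=> /gdot_span Sx nx /wspDE wx.
have genD y : gdot_gen y -> exists be : 'rV[F]_l, eigenvec br Hdot_of be y.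
  by move=> /gdot_gen_wsp [k /wsp_wspD/wspDE wk]; exists (restr (zcomb k)).
have {Sx} := eigen_addspan lie genD Sx wx.
have common y k : gdot_gen y -> y != 0 -> eigenvec br Hdot_of nu y -> wsp (zcomb k) y ->
    nu = restr (zcomb k).
  by move=> gy ny wy /wsp_wspD/wspDE wk; apply: (eigen_uniq ny wy wk).
move=> Sx; have [k nuE] : exists k, nu = restr (zcomb k).
  elim: Sx nx {wx} => [|y z [gy wy] _ IH]; first by rewrite eqxx.
  case: (eqVneq y 0) => [->|ny _]; first by rewrite add0r.
  by have [k wk] := gdot_gen_wsp gy; exists k; apply: common wk.
exists k; split=> //; elim: Sx {nx wx} => [|y z [gy wy] _ IH]; first exact: (eigen0 lie).
apply: (eigenD lie) => //; case: (eqVneq y 0) => [->|ny]; first exact: (eigen0 lie).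
have [k' wk'] := gdot_gen_wsp gy; have := common _ _ gy ny wy wk'.
by rewrite nuE => /restr_zcomb_inj/eq_zcomb ->.
Qed.

(** T5b at the isotropic root 0 yields a nonisotropic root, which an empty base could not
    represent. *)
Lemma ex_index : exists i : 'I_l, True.
Proof.
have [al [Ral _]] := t5b (conj root0 (fdot0l 0)).
have [mu [Rm ra]] := root_Rdot (proj1 Ral).
apply: NNPP => nex; have := root_x_Rdot_neq0 Ral ra.
have [k [-> _]] := Rdot_zcomb Rm; rewrite /Defs.zcomb big1 ?eqxx // => i _.
by case: nex; exists i.
Qed.

Lemma Hdot_nondeg (a : 'rV[F]_l) :
  (forall i, \sum_(j < l) a 0 j * fdot (ad j) (ad i) = 0) -> a = 0.
Proof.
(* The determinant of the integral Cartan matrix is nonzero, hence nonzero in [F]. *)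
move=> aG.
pose cart (ij : 'I_l * 'I_l) (z : int) :=
  2 * fdot (ad ij.1) (ad ij.2) = z%:~R * fdot (ad ij.2) (ad ij.2).
have /fin_all_exists[C CP] : forall ij, exists z : int, cart ij z.
  by move=> ij; have [z [zE _]] := root_string (ad_root_x ij.2) (ad_root ij.1); exists z.
pose M : 'M[int]_l := \matrix_(i, j) C (i, j).
have detM : \det M != 0.
  apply/negP => /det0P[v v0 vM]; case/eqP: v0; apply/rowP => i; rewrite mxE.
  apply: (zcomb_orth (k := fun i => v 0 i)) => j; apply: (mulfI two_neq0); rewrite mulr0.
  rewrite fdot_suml mulr_sumr (eq_bigr (fun i => (v 0 i * M i j)%:~R * fdot (ad j) (ad j))).
    rewrite -mulr_suml -raddf_sum /=; have /rowP/(_ j) := vM.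
    by rewrite !mxE => ->; rewrite mul0r.
  by move=> i' _; rewrite fdotZl mulrCA (CP (i', j)) mxE intrM mulrA.
have : \det (map_mx intr M : 'M[F]_l) != 0 by rewrite det_map_mx (intF_eq0 char0).
apply: contraNeq => a0; apply/det0P; exists a => //; apply/rowP => j; rewrite !mxE.
apply: (mulIf (ad_norm j)); rewrite mul0r mulr_suml.
transitivity (2 * \sum_(i < l) a 0 i * fdot (ad i) (ad j)); last by rewrite aG mulr0.
rewrite mulr_sumr; apply: eq_bigr => i _.
by rewrite !mxE -mulrA -(CP (i, j)) mulrCA.
Qed.

Lemma in_Hdot_eq0 x : in_Hdot x -> (forall i, br x (e i) = 0) -> x = 0.
Proof.
case=> a -> H; suff -> : a = 0 by rewrite /Defs.Hdot_of big1 // => i _; rewrite mxE scale0r.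
apply: Hdot_nondeg => i; have /eqP := H i; rewrite (wsp_wspD (wsp_e i)).
rewrite scaler_eq0 (negPf (e_neq0 i)) orbF => /eqP {2}<-.
by apply: eq_bigr => j _; rewrite restrE fdotC.
Qed.

(** * Ideals and simplicity *)

Section Ideal.
Variable I : L -> Prop.
Hypotheses (Ig : forall x, I x -> gdot x) (I0 : I 0)
  (IL : forall a x y, I x -> I y -> I (a *: x + y))
  (Ibr : forall x y, gdot x -> I y -> I (br x y)).

Lemma IZ a x : I x -> I (a *: x).
Proof. by move=> Ix; rewrite -[_ *: _]addr0; apply: IL. Qed.
Lemma IZK a x : a != 0 -> I (a *: x) -> I x.
Proof. by move=> a0 /(IZ a^-1); rewrite scalerA mulVf // scale1r. Qed.
Lemma IbrC x y : I x -> gdot y -> I (br x y).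
Proof. by move=> Ix gy; rewrite (br_anti lie) -scaleN1r; apply: IZ; apply: Ibr. Qed.

(** Some weight component of [x] is nonzero and lies in [I]. If its weight is zero, the component
    lies in [Hdot], and its bracket with a suitable [e i] is nonzero of weight [ad i]. *)
Lemma ideal_weight x : I x -> x != 0 ->
  exists y k, [/\ I y, y != 0, wsp (zcomb k) y & zcomb k != 0].
Proof.
move=> Ix nx; apply: NNPP => nex.
have [s [sP xE]] : exists s : seq ('rV[F]_l * L),
    (forall p, p \in s -> gdot p.2 /\ wspD p.1 p.2) /\ x = \sum_(p <- s) p.2.
  apply: (addspan_keyed (P := fun (nu : 'rV[F]_l) y => gdot y /\ wspD nu y)).
  apply: addspan_sub (gdot_span (Ig Ix)) => y gy; apply: addspan_in.
  have [k wk] := gdot_gen_wsp gy; exists (restr (zcomb k)); split.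
    exact: gdot_gen_gdot.
  exact: wsp_wspD.
have Ew p : p \in s -> eigenvec br Hdot_of p.1 p.2 by move=> /sP[_ /wspDE].
have Icomp (nu : 'rV[F]_l) : I (\sum_(p <- s | p.1 == nu) p.2).
  apply: (eigen_component lie IL _ Ew); last by rewrite -xE.
  by move=> a y Iy; apply: Ibr => //; apply: Hdot_gdot; exists a.
have gcomp (nu : 'rV[F]_l) : gdot (\sum_(p <- s | p.1 == nu) p.2) := Ig (Icomp nu).
have [nu ncomp] : exists nu : 'rV[F]_l, \sum_(p <- s | p.1 == nu) p.2 != 0.
  apply: NNPP => all0; case/eqP: nx; rewrite xE (sum_by_key s predT) big1 // => nu _.
  by apply: NNPP => /eqP n0; case: all0; exists nu.
set y := \sum_(p <- s | p.1 == nu) p.2 in ncomp.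
have wy : wspD nu y.
  by apply/wspDE; apply: (eigen_sum lie) => p ps /eqP <-; apply: Ew.
have [k [_ wk]] := gdot_wspD (gcomp nu) ncomp wy.
case: (eqVneq (zcomb k) 0) => [k0|nk]; last by case: nex; exists y, k; split=> //; apply: Icomp.
rewrite k0 in wk; have Hy := gdot_0 (gcomp nu) wk.
case/eqP: ncomp; apply: (in_Hdot_eq0 Hy) => i.
apply: NNPP => /eqP nb; case: nex; exists (br y (e i)), (fun j => if j == i then 1 else 0).
rewrite zcomb_delta1; split=> //; last exact: ad_neq0.
  by apply: IbrC; [apply: Icomp | apply: gdot_e].
by rewrite -[ad i]add0r; apply: (eigen_br lie wk (wsp_e i)).
Qed.

(** Reflections move a nonzero weight vector inside [I] to a simple weight, whose weight space is
    spanned by [e i]. *)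
Lemma ideal_e x : I x -> x != 0 -> exists i, I (e i).
Proof.
move=> Ix nx; have [y [k [Iy ny wy nk]]] := ideal_weight Ix nx.
have Rk := gdot_weight_Rred (Ig Iy) ny wy.
have := @Rred_ind (fun nu => forall y, I y -> y != 0 -> wsp nu y -> exists i, I (e i)).
move=> /(_ _ _ _ Rk nk y Iy ny wy); apply.
  move=> i {wy ny Iy}y Iy ny wy; have [a yE] := gdot_ad (Ig Iy) wy; exists i.
  apply: (@IZK a); last by rewrite -yE.
  by apply: contraNneq ny => a0; rewrite yE a0 scale0r.
move=> i nu z zE IH {wy ny Iy}y Iy ny wy.
have [w [Iw nw ww]] := gdot_reflect Ibr Iy ny wy (reflect_back zE).
by apply: (IH w) => //; move: ww; rewrite mulrNz opprK subrK.
Qed.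

Lemma ideal_hv i : I (e i) -> I (hv (ad i)).
Proof. by move=> Ie; have [_ _ <-] := ef_triple i; apply: IbrC => //; apply: gdot_f. Qed.
Lemma ideal_f i : I (e i) -> I (f i).
Proof.
move=> /ideal_hv Ih; have := IbrC Ih (gdot_f i).
rewrite (wsp_hv _ (wsp_f i)) fdotNl mulrN mulNr mulfK ?ad_norm //.
by apply: IZK; rewrite oppr_eq0 two_neq0.
Qed.
Lemma ideal_adj i j : I (e i) -> fdot (ad j) (ad i) != 0 -> I (e j).
Proof.
move=> /ideal_hv Ih nij; have := IbrC Ih (gdot_e j).
rewrite (wsp_hv _ (wsp_e j)); apply: IZK.
by rewrite !mulf_neq0 ?two_neq0 ?invr_neq0 ?ad_norm.
Qed.
End Ideal.

(** If [J] missed some index, it would be orthogonal to its complement. Every nonzero element of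
    [Rdot] would then be supported on one side, by [Rred_ind] and doubling, and the nonisotropic
    roots would split against T5a. *)
Lemma base_connected (J : 'I_l -> Prop) : (exists i, J i) ->
  (forall i j, J i -> fdot (ad j) (ad i) != 0 -> J j) -> forall j, J j.
Proof.
move=> [i0 Ji0] Jadj j0; apply: NNPP => nJj0.
have orth i j : J i -> ~ J j -> fdot (ad j) (ad i) = 0.
  by move=> Ji nJj; apply/eqP; apply: contraT => nij; case: nJj; apply: Jadj nij.
pose supp_in (A : 'I_l -> Prop) nu := exists k, nu = zcomb k /\ forall i, ~ A i -> k i = 0.
pose J' i := ~ J i.
have on_orth nu nu' : supp_in J nu -> supp_in J' nu' -> fdot nu nu' = 0.
  move=> [k [-> kJ]] [k' [-> kJ']]; rewrite fdot_zcomb_r big1 // => i _.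
  case: (classic (J i)) => Ji; first by rewrite kJ' ?mul0r // => /(_ Ji).
  rewrite fdotC fdot_zcomb_r big1 ?mulr0 // => j _.
  case: (classic (J j)) => Jj; last by rewrite kJ // mul0r.
  by rewrite orth ?mulr0.
have on_ad (A : 'I_l -> Prop) i : A i -> supp_in A (ad i).
  move=> Ai; exists (fun j => if j == i then 1 else 0); rewrite zcomb_delta1; split=> // j.
  by case: eqP => [->|].
have on_sub A nu i z : A i -> supp_in A nu -> supp_in A (nu - ad i *~ z).
  move=> Ai [k [-> kA]]; exists (fun j => k j - if j == i then z else 0).
  rewrite -zcombB zcomb_delta; split=> // j nAj; rewrite kA //.
  by case: eqP nAj => [->|].
have on_two A nu : supp_in A nu -> supp_in A (2 *: nu).
  move=> [k [-> kA]]; exists (fun j => 2 * k j); split; last by move=> i /kA ->; rewrite mulr0.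
  by rewrite scaler_sumr; apply: eq_bigr => i _; rewrite scalerA intrM.
(* A reflection in a simple root of the other side is trivial. *)
have zero nu i z : 2 * fdot nu (ad i) = z%:~R * fdot (ad i) (ad i) -> fdot nu (ad i) = 0 -> z = 0.
  move=> zE n0; apply/eqP; rewrite -(intF_eq0 char0).
  by move: zE; rewrite n0 mulr0 => /esym/eqP; rewrite mulf_eq0 (negPf (ad_norm i)) orbF.
have split_red nu : in_Rred nu -> nu != 0 -> supp_in J nu \/ supp_in J' nu.
  apply: (Rred_ind (P := fun nu => supp_in J nu \/ supp_in J' nu)) => [i|i {}nu z zE].
    by case: (classic (J i)) => Ji; [left | right]; apply: on_ad.
  move=> [nJ|nJ']; case: (classic (J i)) => Ji.
  - by left; apply: on_sub.
  - by left; rewrite (zero _ _ _ zE) ?mulr0z ?subr0 //; apply: on_orth => //; apply: on_ad.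
  - right; rewrite (zero _ _ _ zE) ?mulr0z ?subr0 //.
    by rewrite fdotC; apply: on_orth => //; apply: on_ad.
  by right; apply: on_sub.
have split_all nu : in_Rdot nu -> nu != 0 -> supp_in J nu \/ supp_in J' nu.
  move=> Rn n0; case: (Rdot_half Rn n0) => [Rr|[nu' [Rr n'0 ->]]]; first exact: split_red.
  by case: (split_red _ Rr n'0) => H; [left | right]; apply: on_two.
pose P al := exists mu, [/\ in_Rdot mu, rad (al - mu) & supp_in J mu].
have [||al [be [Ral [[mu [Rm ra oJ]] [Rbe [nP]]]]]] := t5a (P := P).
- exists (ad i0); split; first exact: ad_root_x.
  by exists (ad i0); split; [apply: ad_Rdot | rewrite subrr; apply: rad0 | apply: on_ad].
- exists (ad j0); split; first exact: ad_root_x.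
  move=> [mu [Rm ra oJ]]; case/eqP: (ad_norm j0).
  by rewrite (fdot_root (ad_root j0) ra); apply: on_orth => //; apply: on_ad.
have [nu [Rn rb]] := root_Rdot (proj1 Rbe).
rewrite (fdot_Rdot2 (proj1 Ral) (proj1 Rbe) Rm Rn ra rb).
case: (split_all nu Rn (root_x_Rdot_neq0 Rbe rb)) => [oJn|oJn].
  by case: nP; exists nu.
by rewrite on_orth ?eqxx.
Qed.

(** A nonzero ideal contains some [e i], hence its coroot, hence every [e j] not orthogonal to it;
    connectedness of the base gives all generators. *)
Lemma gdot_simple (I : L -> Prop) : (forall x, I x -> gdot x) -> I 0 ->
  (forall a x y, I x -> I y -> I (a *: x + y)) ->
  (forall x y, gdot x -> I y -> I (br x y)) ->
  (forall x, I x -> x = 0) \/ (forall x, gdot x -> I x).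
Proof.
move=> Ig I0 IL Ibr; case: (classic (exists x, I x /\ x != 0)) => [[x [Ix nx]]|nex]; last first.
  by left=> x Ix; apply: NNPP => /eqP nx; case: nex; exists x.
right=> z gz; case: (ideal_e Ig I0 IL Ibr Ix nx) => i Ie.
have all_e : forall j, I (e j).
  by apply: base_connected; [exists i | move=> i' j; apply: ideal_adj].
apply: (gen_subalg_sub lie I0 IL _ _ gz) => [y [j [->|->]]|y y' [j [->|->]] Iy'].
- exact: all_e.
- exact: ideal_f.
- exact: Ibr (gdot_e j) Iy'.
exact: Ibr (gdot_f j) Iy'.
Qed.

(** * Finite dimension and the grading pair *)

Lemma Rdot_height : exists K : nat, forall k, in_Rdot (zcomb k) -> `|\sum_(i < l) k i| <= K%:Z.
Proof.
have [s sP] := Rdot_finite.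
suff [K KP] : exists K : nat, forall k, zcomb k \in s -> `|\sum_(i < l) k i| <= K%:Z.
  by exists K => k /sP; apply: KP.
elim: s {sP} => [|mu s [K KP]]; first by exists 0%N.
case: (classic (exists k, mu = zcomb k)) => [[k0 ->]|nk].
  exists (K + absz (\sum_(i < l) k0 i)%R)%N => k; rewrite inE => /orP[/eqP/zcomb_eq E|/KP].
    by rewrite (eq_bigr _ (fun i _ => E i)); move: (\sum_(i < l) k0 i) => z; lia.
  by move: (\sum_(i < l) k i) (\sum_(i < l) k0 i) => z z0; lia.
exists K => k; rewrite inE => /orP[/eqP E|]; last exact: KP.
by case: nk; exists k.
Qed.

Lemma gdot_finite_dim : exists m (b : 'I_m -> L), forall x,
  gdot x <-> exists a : 'I_m -> F, x = \sum_(j < m) a j *: b j.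
Proof.
have [K KP] := Rdot_height.
(* A nonzero word has at most [K] letters: its sign, innermost letter and remaining letters range
   over a finite type. The second summand indexes [Hdot]. *)
pose v (t : (bool * 'I_l * K.-bseq 'I_l) + 'I_l) :=
  match t with inl (b, i, w) => word (if b then e else f) i w | inr i => tv (ad i) end.
apply: (finite_span (v := v)) => x; split; last first.
  apply: (addspan_subalg sgd) => _ [a [[[[b i] w]|i] ->]]; apply: (subalgZ sgd).
    by apply: word_gdot; case: (b) => j; [apply: gdot_e | apply: gdot_f].
  exact: gdot_tv.
move=> /gdot_span; apply: addspan_sub => y gy.
case: (eqVneq y 0) => [->|ny]; first by constructor.
have [k wk] := gdot_gen_wsp gy.
have Rk := KP k (proj1 (gdot_weight_Rred (gdot_gen_gdot gy) ny wk)).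
case: (gdot_gen_weight gy ny wk) => [[a [i [w [-> kE]]]]|[a [i [w [-> kE]]]]|[[a ->] _]].
- have wK : (size w <= K)%N.
    by move: Rk; rewrite (eq_bigr _ (fun j _ => kE j)) sum_mult /=; lia.
  by apply: addspan_in; exists a, (inl (true, i, Bseq wK)).
- have wK : (size w <= K)%N.
    by move: Rk; rewrite (eq_bigr _ (fun j _ => kE j)) sumrN sum_mult /=; lia.
  by apply: addspan_in; exists a, (inl (false, i, Bseq wK)).
rewrite /Defs.Hdot_of; elim/big_ind: _ => [||i _]; first by constructor.
  exact: addspanD.
by apply: addspan_in; exists (a 0 i), (inr i).
Qed.

(** The normalizer is stable under the torus, so it contains the weight components of [x]. A
    component [y] of nonzero weight would have a nonzero multiple [[y, t_i]] in [Hdot], which has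
    weight zero. *)
Lemma Hdot_self_normalizing x : gdot x ->
  (forall y, in_Hdot y -> in_Hdot (br x y)) -> in_Hdot x.
Proof.
move=> gx Nx; pose M y := forall z, in_Hdot z -> in_Hdot (br y z).
have ML a y z : M y -> M z -> M (a *: y + z).
  by move=> My Mz w Hw; rewrite (brDl lie) (brZl lie); apply: in_HdotL; auto.
(* By Jacobi [[[h, y], z]] vanishes: [[y, z]] and [z] lie in the abelian torus. *)
have MH c y : M y -> M (br (hvec c) y).
  move=> My z Hz; have [a zE] := Hz; have [d zE'] := Hdot_hvec a.
  suff -> : br (br (hvec c) y) z = 0 by apply: in_Hdot0.
  have [b yE] := My z Hz; have [d' yE'] := Hdot_hvec b.
  have := br_jacobi lie (hvec c) y z.
  rewrite {1}yE yE' hvec_comm zE zE' hvec_comm (br0r lie) addr0 => ->.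
  by [].
suff wx : wsp 0 x by apply: gdot_0.
have [s [sP xE]] : exists s : seq ('rV[F]_n * L),
    (forall p, p \in s -> gdot p.2 /\ wsp p.1 p.2) /\ x = \sum_(p <- s) p.2.
  apply: (addspan_keyed (P := fun be y => gdot y /\ wsp be y)).
  apply: addspan_sub (gdot_span gx) => y gy; apply: addspan_in.
  by have [k wk] := gdot_gen_wsp gy; exists (zcomb k); split=> //; apply: gdot_gen_gdot.
rewrite xE (sum_by_key s predT); apply: (eigen_sum lie) => al _ _.
set y := \sum_(p <- s | p.1 == al) p.2.
have My : M y.
  apply: (eigen_component lie ML MH); last by rewrite -xE.
  by move=> p /sP[].
have gy : gdot y by rewrite /y; apply: (subalg_sum sgd) => p ps _; case: (sP p ps).
have wy : wsp al y.
  by apply: (eigen_sum lie) => p ps /eqP <-; case: (sP p ps).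
case: (eqVneq y 0) => [->|ny]; first exact: (eigen0 lie).
have wD := wsp_wspD wy; have [k [alE wk]] := gdot_wspD gy ny wD.
have al_k : al = zcomb k := eigen_uniq ny wy wk.
case: (eqVneq (zcomb k) 0) => [k0|nk]; first by rewrite al_k k0 in wy.
case/negP: nk; rewrite -zcomb0; apply/eqP/eq_zcomb; apply: zcomb_orth => i.
apply/eqP; apply: contraT => ni.
have := My _ (in_Hdot_tv i 1); rewrite scale1r (br_anti lie) (wsp_tv _ wk) -scaleNr.
move=> /Hdot_wsp0 w0.
have nz : (- fdot (zcomb k) (ad i)) *: y != 0 by rewrite scaler_eq0 oppr_eq0 negb_or ni.
have := eigen_uniq nz w0 (eigenZ lie _ wk) => z0.
by move: ni; rewrite -z0 fdot0l eqxx.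
Qed.

Lemma gdot_grading_pair : grading_pair br B h ad e f.
Proof.
split; first exact: gdot_finite_dim.
split.
  have [i _] := ex_index; exists (e i), (f i); split; first exact: gdot_e.
  split; first exact: gdot_f.
  by have [_ _ ->] := ef_triple i; apply: hv_neq0; apply: ad_norm.
split; first exact: gdot_simple.
split; first exact: Hdot_gdot.
split.
  split; first exact: in_Hdot0.
  split; first exact: in_HdotL.
  by move=> x y Hx Hy; rewrite Hdot_comm //; apply: in_Hdot0.
split.
  exists 1%N => -[|x [|]] // y _ xs Hy /=; apply: Hdot_comm => //.
  by apply: xs; rewrite mem_head.
split; first exact: Hdot_self_normalizing.
split.
  apply: dsumI => [nu|nu x y [gx wx] [gy wy]|x /gdot_span|s us sP s0 p ps].
  - by split; [apply: (subalg0 sgd) | apply/wspDE; apply: (eigen0 lie)].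
  - split; first exact: (subalgD sgd).
    by apply/wspDE; apply: (eigenD lie); apply/wspDE.
  - apply: addspan_sub => y gy; apply: addspan_in.
    have [k wk] := gdot_gen_wsp gy; exists (restr (zcomb k)); split=> //.
    by split; [apply: gdot_gen_gdot | apply: wsp_wspD].
  apply: (eigen_component_uniq lie (H := Hdot_of) (I := fun x => x = 0)) us _ s0 p ps.
  - by move=> a x y -> ->; rewrite scaler0 addr0.
  - by move=> c x ->; rewrite (br0r lie).
  by move=> q /sP[_ [_ /wspDE]].
move=> nu; split=> [[x [nx [gx wx]]]|[mu [Rm ->]]].
  have [k [nuE wk]] := gdot_wspD gx nx wx; exists (zcomb k); split=> //.
  exact: gdot_weight_Rred wk.
case: (eqVneq mu 0) => [m0|m0].
  have [i _] := ex_index; exists (tv (ad i)); split.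
    by apply: contraNneq (ad_neq0 i) => /tv_eq0 ->.
  split; first exact: gdot_tv.
  rewrite m0; apply: wsp_wspD; apply: Hdot_wsp0.
  by rewrite -[tv _]scale1r; apply: in_Hdot_tv.
have [x [gx nx wx]] := Rred_weight Rm m0; exists x; split=> //; split=> //.
exact: wsp_wspD.
Qed.

(** For irreducibility, a predicate on [Rdot] is pulled back to roots by congruence modulo the
    radical, where T5a applies. *)
Lemma Rdot_root_system : Rdot_irred_finite_root_system br B h ad.
Proof.
split; first exact: Rdot_finite.
split; first exact: Rdot0.
split=> [mu nu Rm m0 Rn _|P [mu [Rm [m0 Pm]]] [nu [Rn [n0 nPn]]]].
  have [z [zE Rz]] := Rdot_cart Rm Rn m0; have [_ [al [Ra ra]]] := Rm.
  have [_ nal] := Rdot_neq0 Ra Rm ra m0; rewrite (fdot_Rdot2 Ra Ra Rm Rm ra ra) in nal.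
  by rewrite zE mulfK // scaler_int; split=> //; split=> //; exists z.
have [_ [al [Ra ra]]] := Rm; have [_ [be [Rb rb]]] := Rn.
pose P' ga := exists la, [/\ in_Rdot la, rad (ga - la) & P la].
have [||ga [ga' [Rg [[la [Rl rl Pl]] [Rg' [nP' ng]]]]]] := t5a (P := P').
- by exists al; split; [apply: Rdot_neq0 ra m0 | exists mu].
- exists be; split; first exact: Rdot_neq0 rb n0.
  move=> [la [Rl rl Pl]]; case: nPn; suff -> : nu = la by [].
  apply: Rdot_uniq => //; have -> : nu - la = be - la - (be - nu).
    by rewrite opprB [RHS]addrC addrA subrK.
  exact: radB.
have [la' [Rl' rl']] := root_Rdot (proj1 Rg'); exists la, la'.
have nl := root_x_Rdot_neq0 Rg rl; have nl' := root_x_Rdot_neq0 Rg' rl'.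
rewrite -(fdot_Rdot2 (proj1 Rg) (proj1 Rg') Rl Rl' rl rl').
do 5 split=> //; split=> // Pl'; case: nP'; by exists la'.
Qed.

(** * The core *)

Notation in_core := (in_core br B h).
Notation core_sig := (core_sig br B h ad).
Notation core_wt := (core_wt br B h ad).
Notation in_Lsig := (in_Lsig br B h ad).

Let score : subalg br in_core := subalg_gen _ _.

Lemma core_root al x : root_x al -> wsp al x -> in_core x.
Proof. by move=> Ra wx; apply: gen_subalg_in; exists al. Qed.

(** The second kind accounts for the isotropic weights of the core. It is kept as a bracket because
    the zero weight space must be a sum of brackets of opposite weight spaces. *)
Definition core_gen y : Prop :=
  (exists al, root_x al /\ wsp al y) \/
  (exists al be a b, [/\ root_x al, root_x be, rad (al + be) &
     [/\ wsp al a, wsp be b & y = br a b]]).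

Lemma core_gen_core y : core_gen y -> in_core y.
Proof.
case=> [[al [Ra wy]]|[al [be [a [b [Ra Rb _ [wa wb ->]]]]]]]; first exact: core_root wy.
by apply: (subalg_br score); [apply: core_root wa | apply: core_root wb].
Qed.
Lemma core_gen_wsp y : core_gen y -> exists al, wsp al y.
Proof.
case=> [[al [_ wy]]|[al [be [a [b [_ _ _ [wa wb ->]]]]]]]; first by exists al.
by exists (al + be); apply: (eigen_br lie).
Qed.
Lemma core_genZ (c : F) y : core_gen y -> core_gen (c *: y).
Proof.
case=> [[al [Ra wy]]|[al [be [a [b [Ra Rb rab [wa wb ->]]]]]]].
  by left; exists al; split=> //; apply: (eigenZ lie).
right; exists al, be, (c *: a), b; split=> //.
by rewrite (brZl lie); split=> //; apply: (eigenZ lie).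
Qed.

(** A bracket of two nonisotropic weight vectors has nonisotropic weight or a weight in the radical;
    bracketing a vector of weight [ga] with a generator of radical weight leaves the norm of [ga]
    unchanged. *)
Lemma core_span x : in_core x -> addspan core_gen x.
Proof.
apply: (gen_subalg_sub lie) => [|a y z Sy Sz|y [al [Ra wy]]|y z [ga [Rg wy]]].
- by constructor.
- by apply: addspanD Sz; apply: addspanZ Sy; apply: core_genZ.
- by apply: addspan_in; left; exists al.
elim=> [|{}z w cz _ IH]; first by rewrite (br0r lie); constructor.
rewrite (brDr lie); apply: addspanD => //.
case: (eqVneq (br y z) 0) => [->|nyz]; first by constructor.
apply: addspan_in; case: cz nyz => [[al [Ra wz]] nyz|[al [be [a [b [Ra Rb rab [wa wb ->]]]]]] nyz].
  have wyz := eigen_br lie wy wz; have Rs : root (ga + al) by exists (br y z).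
  case: (eqVneq (fdot (ga + al) (ga + al)) 0) => [n0|n0]; last by left; exists (ga + al).
  right; exists ga, al, y, z; split=> //; exact: rad_root_0 (conj Rs n0).
have wyz := eigen_br lie wy (eigen_br lie wa wb).
left; exists (ga + (al + be)); split=> //; split; first by exists (br y (br a b)).
have [[Rgr ng] [Rar _] [Rbr _]] := And3 Rg Ra Rb.
rewrite fdotDl [fdot (al + be) _]fdotDr rab // [fdot _ (al + be)]fdotDr !rab // !addr0.
by rewrite fdotDr [fdot ga (al + be)]fdotC rab // addr0.
Qed.

Lemma LsigD s (x y : L) : in_Lsig s x -> in_Lsig s y -> in_Lsig s (x + y).
Proof.
move=> [ps [psP ->]] [qs [qsP ->]]; exists (ps ++ qs); rewrite big_cat; split=> // p.
by rewrite mem_cat => /orP[/psP|/qsP].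
Qed.
Lemma Lsig0 s : in_Lsig s 0. Proof. by exists [::]; rewrite big_nil. Qed.
Lemma Lsig_wsp s mu x : in_Rdot mu -> wsp (mu + s) x -> in_Lsig s x.
Proof.
move=> Rm wx; exists [:: (mu, x)]; rewrite big_seq1; split=> // p.
by rewrite inE => /eqP ->.
Qed.

Lemma gdot_core x : gdot x -> in_core x.
Proof.
move=> gx; apply: gx => // y [i [->|->]].
  by apply: core_root (ad_root_x i) (wsp_e i).
by apply: core_root (root_xN (ad_root_x i)) (wsp_f i).
Qed.

Lemma core_wt_dsum :
  dsum (fun nu : 'rV[F]_l => exists mu, in_Rdot mu /\ nu = restr mu) core_wt in_core.
Proof.
apply: dsumI => [nu|nu x y [gx wx] [gy wy]|x /core_span|s us sP s0 p ps].
- by split; [apply: (subalg0 score) | apply/wspDE; apply: (eigen0 lie)].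
- split; first exact: (subalgD score).
  by apply/wspDE; apply: (eigenD lie); apply/wspDE.
- apply: addspan_sub => y cy; have [al wy] := core_gen_wsp cy.
  have [->|Ra] := wsp_root wy; first by constructor.
  have [mu [Rm ra]] := root_Rdot Ra; apply: addspan_in; exists (restr mu); split.
    by exists mu.
  split; first exact: core_gen_core.
  by rewrite -[mu](subKr al) restrD restrN (restr_rad ra) subr0; apply: wsp_wspD.
apply: (eigen_component_uniq lie (H := Hdot_of) (I := fun x => x = 0)) us _ s0 p ps.
- by move=> a x y -> ->; rewrite scaler0 addr0.
- by move=> c x ->; rewrite (br0r lie).
by move=> q /sP[_ [_ /wspDE]].
Qed.

Lemma core_Rdot_graded : Rdot_graded br B h ad e f.
Proof.
split; first exact: gdot_core.
split; first exact: core_wt_dsum.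
move=> x; split=> [[cx /wspDE wx]|[ps [psP ->]]]; last first.
  split.
    apply: (subalg_sum score) => p /psP[_ [_ [[c1 _] [c2 _]]]] _; exact: (subalg_br score).
  apply/wspDE; apply: (eigen_sum lie) => p /psP[_ [_ [[_ /wspDE w1] [_ /wspDE w2]]]] _.
  by have := eigen_br lie w1 w2; rewrite restrN subrr.
have genD y : core_gen y -> exists be : 'rV[F]_l, eigenvec br Hdot_of be y.
  by move=> /core_gen_wsp [al /wsp_wspD/wspDE wk]; exists (restr al).
have := eigen_addspan lie genD (core_span cx) wx.
elim=> [|y z [cy wy] _ [ps [psP ->]]]; first by exists [::]; rewrite big_nil.
case: (eqVneq y 0) => [->|ny]; first by rewrite add0r; exists ps.
case: cy ny wy => [[al [Ra wa]] ny wy|[al [be [a [b [Ra Rb rab [wa wb ->]]]]]] ny wy].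
  (* A nonisotropic weight restricts to [Hdot] as a nonzero [mu] does, so this kind of generator
     cannot have weight zero. *)
  have [mu [Rm ra]] := root_Rdot (proj1 Ra); case/eqP: (root_x_Rdot_neq0 Ra ra).
  apply: restr_Rdot_inj => //; first exact: Rdot0.
  rewrite restr0 -[mu](subKr al) restrD restrN (restr_rad ra) subr0.
  by move/wsp_wspD/wspDE: wa => wa; apply: (eigen_uniq ny wa wy).
have [mu [Rm ra]] := root_Rdot (proj1 Ra).
exists ((mu, a, b) :: ps); rewrite big_cons; split=> // p.
rewrite inE => /orP[/eqP ->|/psP //] /=.
have aE : restr al = restr mu.
  by rewrite -[al](subrK mu) restrD (restr_rad ra) add0r.
have bE : restr be = restr (- mu).
  by rewrite restrN -aE -restrN -[be](addKr al) restrD (restr_rad rab) addr0.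
split=> //; split; first exact: root_x_Rdot_neq0 ra.
split; split; [exact: core_root wa | rewrite -aE; exact: wsp_wspD
  | exact: core_root wb | rewrite -bE; exact: wsp_wspD].
Qed.

(** * The [Lambda]-grading and the division property *)

Lemma Lsig_weights s x : in_Lsig s x -> exists S : seq ('rV[F]_n * L),
  (forall p, p \in S -> wsp p.1 p.2 /\ in_Rdot (p.1 - s)) /\ x = \sum_(p <- S) p.2.
Proof.
move=> [ps [psP ->]]; exists [seq (p.1 + s, p.2) | p <- ps]; split; last by rewrite big_map.
by move=> _ /mapP[p /psP[Rp wp] ->] /=; rewrite addrK.
Qed.

(** A weight [al] occurs in degree [s] only if [al - s] is in [Rdot]. As [Lambda] lies in the
    radical and [Rdot] meets each class modulo the radical at most once, distinct degrees involve
    distinct weights, which are independent. *)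
Lemma core_sig_indep (s : seq ('rV[F]_n * L)) : uniq (map fst s) ->
  (forall p, p \in s -> in_Lambda p.1 /\ core_sig p.1 p.2) ->
  \sum_(p <- s) p.2 = 0 -> forall p, p \in s -> p.2 = 0.
Proof.
move=> us sP s0 p0 p0s; rewrite -(sum_uniq_key us p0s).
have [Rl RlP] := Rdot_finite; have [L0 _] := sP p0 p0s.
have [S [SP SE Sq]] : exists S : seq ('rV[F]_n * L), [/\ forall p, p \in S -> wsp p.1 p.2,
    \sum_(p <- s) p.2 = \sum_(p <- S) p.2 &
    \sum_(p <- s | p.1 == p0.1) p.2 = \sum_(p <- S | p.1 - p0.1 \in Rl) p.2].
  elim: s {us s0 p0s} sP => [|p s IH] sP; first by exists [::]; rewrite !big_nil.
  have [|S [SP SE Sq]] := IH; first by move=> q qs; apply: sP; rewrite inE qs orbT.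
  have [Lp [_ /Lsig_weights [S' [S'P pE]]]] := sP p (mem_head _ _).
  exists (S' ++ S); rewrite !big_cons !big_cat -SE -Sq -pE; split=> //.
    by move=> q; rewrite mem_cat => /orP[/S'P[]|/SP].
  case: eqVneq => [pp0|npp0].
    congr (_ + _); rewrite pE big_seq [RHS]big_seq_cond; apply: eq_bigl => q.
    case: (boolP (q \in S')) => //= /S'P[_]; rewrite pp0 => /RlP ->.
    by [].
  rewrite [X in _ = X + _]big1_seq ?add0r // => q /andP[/RlP Rq qS'].
  have [_ Rq'] := S'P q qS'; case/eqP: npp0.
  have E : q.1 - p.1 = q.1 - p0.1.
    apply: Rdot_uniq => //; rewrite opprB addrC addrA subrK.
    exact: (radB (rad_Lambda L0) (rad_Lambda Lp)).
  by apply/esym/oppr_inj/(addrI q.1).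
rewrite SE in s0; rewrite Sq.
exact: (eigen_indep lie SP s0 (fun al => al - p0.1 \in Rl)).
Qed.

Lemma wsp_Lsig al x : wsp al x -> x = 0 \/
  exists mu s, [/\ in_Rdot mu, in_Lambda s, al = mu + s & in_Lsig s x].
Proof.
move=> wx; have [->|Ra] := wsp_root wx; [by left | right].
have [mu [s [Rm Ls aE]]] := root_Rdot_Lambda Ra; exists mu, s; split=> //.
by apply: (Lsig_wsp Rm); rewrite -aE.
Qed.

Lemma core_Lambda_graded : Lambda_graded br B h ad e f.
Proof.
split.
  apply: dsumI core_sig_indep => [s|s x y [cx sx] [cy sy]|x /core_span].
  - by split; [apply: (subalg0 score) | apply: Lsig0].
  - by split; [apply: (subalgD score) | apply: LsigD].
  apply: addspan_sub => y cy; have [al wy] := core_gen_wsp cy.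
  have [->|[mu [s [_ Ls _ sy]]]] := wsp_Lsig wy; first by constructor.
  by apply: addspan_in; exists s; split=> //; split=> //; apply: core_gen_core.
split.
  move=> s t x y Ls Lt [cx [ps [psP xE]]] [cy [qs [qsP yE]]].
  split; first exact: (subalg_br score).
  rewrite xE (br_suml lie) big_seq; apply: (big_ind (in_Lsig _)) => [||p pps].
  - exact: Lsig0.
  - by move=> u v; apply: LsigD.
  rewrite yE (br_sumr lie) big_seq; apply: (big_ind (in_Lsig _)) => [||q qqs].
  - exact: Lsig0.
  - by move=> u v; apply: LsigD.
  have [Rp wp] := psP p pps; have [Rq wq] := qsP q qqs.
  have wpq := eigen_br lie wp wq; rewrite addrACA in wpq.
  have [->|Rpq] := wsp_root wpq; first exact: Lsig0.
  (* The nonzero bracket makes [p.1 + q.1 + (s + t)] a root; modulo the radical it is [p.1 + q.1],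
     which is thus in [Rdot]. *)
  apply: Lsig_wsp wpq; split.
    have [k [-> _]] := Rdot_zcomb Rp; have [k' [-> _]] := Rdot_zcomb Rq.
    exists (fun i => (k i + k' i)%:~R); rewrite -zcombE -big_split; apply: eq_bigr => i _.
    by rewrite intrD scalerDl.
  exists (p.1 + q.1 + (s + t)); split=> //; rewrite [_ + (s + t)]addrC addrK.
  by apply: rad_Lambda; apply: LambdaD.
split.
  move=> x gx; split; first exact: gdot_core.
  elim: (gdot_span gx) => [|y z gy _]; first exact: Lsig0.
  apply: LsigD; case: (eqVneq y 0) => [->|ny]; first exact: Lsig0.
  have [k wk] := gdot_gen_wsp gy; apply: (@Lsig_wsp _ (zcomb k)); last by rewrite addr0.
  by case: (gdot_weight_Rred (gdot_gen_gdot gy) ny wk).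
move=> s Ls P P0 PB Psupp; apply: Ls => // d Rd.
have in_supp mu t al : in_Rdot mu -> in_Lambda t -> root_x al -> al = mu + t -> P t.
  move=> Rm Lt Ra aE; have [[x [nx wx]] _] := Ra; apply: Psupp => //; exists x; split=> //.
  by split; [apply: core_root wx | apply: (Lsig_wsp Rm); rewrite -aE].
(* The support generates [Lambda]: by T5b an isotropic root [d] is the difference of the degrees of
   the nonisotropic roots [al + d] and [al]. *)
have [al [Ra Rad]] := t5b Rd; have [mu [t [Rm Lt aE]]] := root_Rdot_Lambda (proj1 Ra).
have Lt' : in_Lambda (t + d) by apply: LambdaD => //; apply: Lambda_root_0.
have Pt := in_supp mu t al Rm Lt Ra aE.
have -> : d = t + d - t by rewrite addrC addKr.
apply: PB => //; apply: (in_supp mu (t + d) (al + d)) => //; last by rewrite aE addrA.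
have rd := rad_root_0 Rd; split=> //; have [Rar na] := Ra; have [_ d0] := Rd.
by rewrite fdotDl [fdot d _]fdotDr fdotDr [fdot al d]fdotC !rd ?addr0 //; case: Rd.
Qed.

(** A homogeneous [x] has full weight [mu + s], a nonisotropic root, so T3 gives [[x, y] = t_mu +
    t_s]. The term [t_s] acts on weight [al] by [(s, al) = 0], hence is central in the core. *)
Lemma core_division : division br B h ad.
Proof.
move=> mu Rm m0 s Ls x [cx sx] /wspDE wx nx.
have wms : wsp (mu + s) x.
  have [ps [psP xE]] := sx.
  pose S y := exists nu, in_Rdot nu /\ wsp (nu + s) y.
  have Sx : addspan S x.
    rewrite xE; pose Ps nu y := in_Rdot nu /\ wsp (nu + s) y.
    apply: addspan_sub (keyed_addspan (P := Ps) psP).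
    by move=> y [nu H]; apply: addspan_in; exists nu.
  have SD y : S y -> exists be : 'rV[F]_l, eigenvec br Hdot_of be y.
    by move=> [nu [_ /wsp_wspD/wspDE wn]]; exists (restr (nu + s)).
  elim: (eigen_addspan lie SD Sx wx) => [|y z [[nu [Rn wn]] wy] _ IH]; first exact: (eigen0 lie).
  apply: (eigenD lie) => //; case: (eqVneq y 0) => [->|ny]; first exact: (eigen0 lie).
  (* On [Hdot] the degree [s] restricts to zero, and restriction is injective on [Rdot]. *)
  suff -> : mu = nu by [].
  move/wsp_wspD/wspDE: (wn) => wn'; apply: restr_Rdot_inj => //.
  by rewrite (eigen_uniq ny wy wn') restrD (restr_rad (rad_Lambda Ls)) addr0.
have Ra : root (mu + s) by exists x.
have rs := rad_Lambda Ls.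
have Rx : root_x (mu + s) by apply: (Rdot_neq0 Ra Rm) => //; rewrite addrC addKr.
have [_ /(_ _ Rx x wms nx) [y [wy xy]]] := t3.
have cy : in_core y := core_root (root_xN Rx) wy.
exists y; split.
  by split=> //; apply: (Lsig_wsp (RdotN Rm)); rewrite -opprD.
split.
  have -> : restr (- mu) = restr (- (mu + s)).
    by rewrite !restrN restrD (restr_rad rs) addr0.
  exact: wsp_wspD.
split.
  rewrite -scaleN1r addrC; apply: (subalgL score); last exact: (subalg_br score).
  apply: gdot_core; apply: Hdot_gdot; have [k [-> _]] := Rdot_zcomb Rm.
  exists (\row_i (k i)%:~R); rewrite /Defs.Hdot_of /Defs.zcomb.
  elim/big_rec2: _ => [|i z al _ <-]; last by rewrite tvL mxE.
  by have := tvN 0; rewrite oppr0 => /eqP; rewrite -addr_eq0 -tvD addr0 => /eqP.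
move=> w /core_span; rewrite xy tvD addrC addKr.
elim=> [|y' z cy' _ IH]; first by rewrite (br0r lie).
rewrite (brDr lie) IH addr0; have [al wa] := core_gen_wsp cy'.
have [->|Ral] := wsp_root wa; first by rewrite (br0r lie).
by rewrite (wsp_tv _ wa) fdotC rs // scale0r.
Qed.

Lemma core_division_graded : division_graded_core br B h ad e f.
Proof.
split; first exact: Rdot_root_system.
split; first exact: gdot_grading_pair.
split; first exact: core_Rdot_graded.
split; first exact: core_Lambda_graded.
exact: core_division.
Qed.

End Setup.
End ClassT.

Theorem theorem2p9 (F : fieldType) (L : lmodType F) (br : L -> L -> L) (B : L -> L -> F)
  (n : nat) (h : 'I_n -> L) :
  class_T br B h ->
  forall (l : nat) (ad : 'I_l -> 'rV[F]_n) (e f : 'I_l -> L),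
    standard_setup br B h ad e f ->
    division_graded_core br B h ad e f.
Proof. by move=> HT l ad e f; apply: core_division_graded. Qed.
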